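(* Let $K\subset\mathbb{R}$ be a regular compact set, let $g$ be the Green function of $\overline{\mathbb{C}}\setminus K$ with pole at infinity, and for $\delta>0$ put $$G(\delta):=\max\{ g(z): z\in\mathbb{C},\ \operatorname{dist}(z,K)\le 2\delta\}.$$ Let $0<\tau\le1$, $n\ge1$, and let $x_0,\ldots,x_{n-1}\in K$ be a $\tau$-quasi Leja sequence. Then for every $\delta>0$, $$\Lambda_n\le \frac{2}{\tau^2}\,n\left[ \frac{\operatorname{diam}(K)}{\tau\delta}\, e^{nG(\delta)}\right]^{9/8+2\lambda^{-1}\log(1/\tau)},$$ where $\lambda=0.24565978\ldots$ is the positive root of the equation $e^{e^\lambda}(e^\lambda-1)=1$.
   Context: A compact set $K\subset\mathbb{C}$ is regular if the Green function $g(z)=g_{\overline{\mathbb{C}}\setminus K}(z,\infty)$ of $\overline{\mathbb{C}}\setminus K$ with pole at infinity is continuous on $\mathbb{C}$ (with $g=0$ on $K$). For $0<\tau\le1$, a sequence $x_0,\ldots,x_{n-1}\in K$ is $\tau$-quasi Leja if for every $k=1,\ldots,n-1$, $\prod_{j<k}|x_k-x_j|\ge\tau\max_{x\in K}\prod_{j<k}|x-x_j|$. $C(K)$ is the space of continuous functions $f:K\to\mathbb{C}$ with the uniform norm. The Lagrange interpolation operator $T_n:C(K)\to C(K)$ is $T_nf(x)=\sum_{k=0}^{n-1}f(x_k)L_{k,n}(x)$, where $L_{k,n}(x)=\prod_{0\le j\le n-1,\,j\ne k}\frac{x-x_j}{x_k-x_j}$, and $\Lambda_n=\|T_n\|$ is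 its operator norm (the $n$-th Lebesgue constant). *)

(* Defs.v *)
From Stdlib Require Import Reals.
From Stdlib Require Export Rtopology.
From Coquelicot Require Export Coquelicot.
Open Scope R_scope.

Fixpoint prodR (n : nat) (f : nat -> R) : R :=
  match n with O => 1 | S m => prodR m f * f m end.
Fixpoint sumC (n : nat) (f : nat -> C) : C :=
  match n with O => RtoC 0 | S m => Cplus (sumC m f) (f m) end.

Definition inK (K : R -> Prop) (z : C) : Prop := snd z = 0 /\ K (fst z).

Definition contC (u : C -> R) (z : C) : Prop :=
  forall eps, 0 < eps -> exists d, 0 < d /\
    forall w, Cmod (Cminus w z) < d -> Rabs (u w - u z) < eps.

Definition px (u : C -> R) (z : C) : R := Derive (fun t => u (t, snd z)) (fst z).
Definition py (u : C -> R) (z : C) : R := Derive (fun t => u (fst z, t)) (snd z).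
Definition ex_px (u : C -> R) (z : C) : Prop := ex_derive (fun t => u (t, snd z)) (fst z).
Definition ex_py (u : C -> R) (z : C) : Prop := ex_derive (fun t => u (fst z, t)) (snd z).

Definition harmonic_on (U : C -> Prop) (u : C -> R) : Prop :=
  forall z, U z ->
    ex_px u z /\ ex_py u z /\
    ex_px (px u) z /\ ex_py (px u) z /\ ex_px (py u) z /\ ex_py (py u) z /\
    contC u z /\ contC (px u) z /\ contC (py u) z /\
    contC (px (px u)) z /\ contC (py (px u)) z /\
    contC (px (py u)) z /\ contC (py (py u)) z /\
    px (px u) z + py (py u) z = 0.

(* g is the Green function of (extended C) \ K with pole at infinity:
   harmonic on C \ K, g(z) - log|z| bounded near infinity, and (K being
   regular, see the theorem) g = 0 on K. *)
Definition green_inf (K : R -> Prop) (g : C -> R) : Prop :=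
  harmonic_on (fun z => ~ inK K z) g /\
  (forall z, inK K z -> g z = 0) /\
  (exists M R0, forall z, R0 <= Cmod z -> Rabs (g z - ln (Cmod z)) <= M).

Definition distK (K : R -> Prop) (z : C) : Rbar :=
  Glb_Rbar (fun t => exists x, K x /\ t = Cmod (Cminus z (RtoC x))).

Definition Gfun (K : R -> Prop) (g : C -> R) (delta : R) : R :=
  real (Lub_Rbar (fun t => exists z, Rbar_le (distK K z) (2 * delta) /\ t = g z)).

Definition diam (K : R -> Prop) : R :=
  real (Lub_Rbar (fun t => exists x y, K x /\ K y /\ t = Rabs (x - y))).

Definition quasi_Leja (K : R -> Prop) (tau : R) (n : nat) (xs : nat -> R) : Prop :=
  (forall k, (k < n)%nat -> K (xs k)) /\
  (forall k, (1 <= k)%nat -> (k < n)%nat ->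
     forall x, K x ->
       prodR k (fun j => Rabs (xs k - xs j)) >= tau * prodR k (fun j => Rabs (x - xs j))).

Definition lagrange (n : nat) (xs : nat -> R) (k : nat) (x : R) : R :=
  prodR n (fun j => if Nat.eqb j k then 1 else (x - xs j) / (xs k - xs j)).

Definition interp (n : nat) (xs : nat -> R) (f : R -> C) (x : R) : C :=
  sumC n (fun k => Cmult (f (xs k)) (RtoC (lagrange n xs k x))).

Definition cont_on (K : R -> Prop) (f : R -> C) : Prop :=
  forall x, K x -> forall eps, 0 < eps -> exists d, 0 < d /\
    forall y, K y -> Rabs (y - x) < d -> Cmod (Cminus (f y) (f x)) < eps.

Definition lebesgue_const (K : R -> Prop) (n : nat) (xs : nat -> R) : Rbar :=
  Lub_Rbar (fun t => exists f x, cont_on K f /\ (forall y, K y -> Cmod (f y) <= 1) /\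
                        K x /\ t = Cmod (interp n xs f x)).

(* Main.v *)
(* Fix a node y = x_k.  If a unit mass is split between two points p, q of K on either side
   of y with centre of mass y, then ln |p - t| / |y - t| averaged over the mass is at most 0
   as soon as t is not too close to y.  Run through the nodes added after x_k, from the last
   to the first.  If the average increases at a node x_m, the (quasi) Leja inequality at x_m
   allows the mass of the point on the same side, and part of the other one, to be moved to
   x_m, at the price of one factor 1 / tau.  The equation for lambda says precisely that x_m
   is then closer to y by a factor at least exp lambda, so the number of moves is at most
   2 / lambda times the logarithm of diam K / d, where d is the separation of the nodes.  The
   lower bound for d comes from the Bernstein-Walsh inequality on the line through x_k
   orthogonal to the real axis. *)
Require Import Defs.
From Stdlib Require Import Reals Lra Lia Psatz Classical ClassicalEpsilon.
From Coquelicot Require Import Coquelicot.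
Open Scope R_scope.

(** A single point p cannot be followed past a node on the other side of y: the factor of that node
    exceeds 1, and passing to the node may increase the distance to y. Balance is the remedy. For a
    node at distance s on the side of a point at distance a, the point at distance b on the other
    side gains at most b/s, and the condition on the centre of mass turns this into a term a/s at
    the first point. What remains is the sign of ln(x - 1) + x for x = a/s, which changes at x = exp
    lambda. The exponent is twice 9/16 + ln(1/tau)/lambda: each of two points has a logarithmic
    distance of at most ln(diam K / d) to lose, and every unit lost pays 9/16 for rebalancing and
    ln(1/tau)/lambda for the factors 1/tau. An arbitrary point of K is followed alone while the
    nodes met lie on its side. The first node met on the other side completes it to a pair, at the
    price of ln 2, the maximal binary entropy, and of one factor 1/tau. Another 1/tau comes from the
    Leja inequality at x_k itself, which starts the induction; hence 2/tau^2. *)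

(** * Tangents and rational bounds for the logarithm *)

Lemma ln_le_sub1 (x : R) : 0 < x -> ln x <= x - 1.
Proof.
  intros Hx. rewrite <- (ln_exp (x - 1)).
  apply ln_le; [lra|]. generalize (exp_ineq1_le (x - 1)); lra.
Qed.

Lemma ln_le_tangent (a x : R) : 0 < a -> 0 < x -> ln x <= ln a + x / a - 1.
Proof.
  intros Ha Hx.
  assert (H : 0 < x / a) by (apply Rdiv_lt_0_compat; lra).
  generalize (ln_le_sub1 (x / a) H). rewrite ln_div by lra. lra.
Qed.

Lemma pow_le_exp (x : R) (n : nat) : 0 <= 1 + x -> (1 + x) ^ n <= exp (INR n * x).
Proof.
  intros Hx. induction n as [|n IH].
  - simpl INR. rewrite Rmult_0_l, exp_0. simpl; lra.
  - rewrite S_INR, Rmult_plus_distr_r, Rmult_1_l, (Rplus_comm (INR n * x)), exp_plus. simpl.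
    apply Rmult_le_compat; [exact Hx | apply pow_le; exact Hx | apply exp_ineq1_le | exact IH].
Qed.

(** Certifies a numerical bound by one rational power: [INR n * x] is the bound wanted for [ln y],
    cut into n small parts. Lower bounds are obtained by applying it to an inverse. *)
Lemma ln_le_pow (x y : R) (n : nat) :
  0 <= 1 + x -> 0 < y -> y <= (1 + x) ^ n -> ln y <= INR n * x.
Proof.
  intros Hx Hy H. rewrite <- (ln_exp (INR n * x)).
  apply ln_le; [lra|]. generalize (pow_le_exp x n Hx); lra.
Qed.

Lemma ln_2_bounds : 69 / 100 <= ln 2 <= 695 / 1000.
Proof.
  split.
  - assert (H := ln_le_pow (- 69 / 12800) (/ 2) 128 ltac:(lra) ltac:(lra) ltac:(lra)).
    rewrite ln_Rinv in H by lra. rewrite INR_IZR_INZ in H. simpl in H. lra.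
  - assert (H := ln_le_pow (695 / 256000) 2 256 ltac:(lra) ltac:(lra) ltac:(lra)).
    rewrite INR_IZR_INZ in H. simpl in H. lra.
Qed.

Lemma ln_5_2_lb : 9 / 10 <= ln (5 / 2).
Proof.
  assert (H := ln_le_pow (- 9 / 320) (/ (5 / 2)) 32 ltac:(lra) ltac:(lra) ltac:(lra)).
  rewrite ln_Rinv in H by lra. rewrite INR_IZR_INZ in H. simpl in H. lra.
Qed.

Lemma ln_3_2_ub : ln (3 / 2) <= 41 / 100.
Proof.
  assert (H := ln_le_pow (41 / 3200) (3 / 2) 32 ltac:(lra) ltac:(lra) ltac:(lra)).
  rewrite INR_IZR_INZ in H. simpl in H. lra.
Qed.

(** The tangent at 10/3 has slope 3/10, and its constant term is at most 3/10 because ln(10/3) <=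
    13/10. *)
Lemma ln_le_linear (s : R) : 0 < s -> ln s <= 3 / 10 * (1 + s).
Proof.
  intros Hs.
  assert (H := ln_le_pow (13 / 100) (10 / 3) 10 ltac:(lra) ltac:(lra) ltac:(lra)).
  rewrite INR_IZR_INZ in H. simpl in H.
  generalize (ln_le_tangent (10 / 3) s ltac:(lra) Hs). lra.
Qed.

(** The left-hand side is the binary entropy of the weights 1/(1+s) and s/(1+s). The bound is the
    average, with these weights, of ln x <= x - 1 at the inverse weights divided by 2. *)
Lemma entropy_le_ln2 (s : R) : 0 < s -> ln (1 + s) - s / (1 + s) * ln s <= ln 2.
Proof.
  intros Hs.
  assert (H1 := ln_le_sub1 ((1 + s) / 2) ltac:(lra)).
  assert (H2 := ln_le_sub1 ((1 + s) / (2 * s)) ltac:(apply Rdiv_lt_0_compat; lra)).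
  rewrite ln_div in H1, H2 by lra. rewrite ln_mult in H2 by lra.
  assert (E : 1 / (1 + s) * ((1 + s) / 2 - 1) + s / (1 + s) * ((1 + s) / (2 * s) - 1) = 0)
    by (field; lra).
  assert (E2 : ln (1 + s) - s / (1 + s) * ln s - ln 2 =
    1 / (1 + s) * (ln (1 + s) - ln 2) + s / (1 + s) * (ln (1 + s) - (ln 2 + ln s)))
    by (field; lra).
  assert (0 < 1 / (1 + s)) by (apply Rdiv_lt_0_compat; lra).
  assert (0 < s / (1 + s)) by (apply Rdiv_lt_0_compat; lra).
  nra.
Qed.

(** * The cost of rebalancing *)

Section RebalancingCost.
Variable r : R.
Hypothesis r0 : 0 < r.
Hypothesis r1 : r < 1.

Let L := - ln r.
Let l := - ln (1 - r).

Let L_tan (a : R) : 0 < a -> - ln a + 1 - r / a <= L.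
Proof. intros Ha. unfold L. generalize (ln_le_tangent a r Ha r0). lra. Qed.

Let l_tan (a : R) : 0 < a -> - ln a + 1 - (1 - r) / a <= l.
Proof. intros Ha. unfold l. generalize (ln_le_tangent a (1 - r) Ha ltac:(lra)). lra. Qed.

(** This and the next two lemmas treat the endpoint s = 1 of [two_point_cost], to which both ranges
    of s are reduced. Replacing [L] and [l] by tangents leaves a quadratic inequality in r; the
    tangents are taken at r = 2/5 here, at r = 1/2 in the middle range, and at r = 1 for [L], r =
    3/4 for [l] in the last one. *)
Lemma cost_bound_small : r <= 1 / 2 -> ln 2 + 3 / 10 * (1 - r) <= r * l + 9 / 16 * (1 + r) * L.
Proof.
  intros Hr.
  assert (H1 := L_tan (/ (5 / 2)) ltac:(lra)).
  assert (H2 := l_tan (/ (5 / 3)) ltac:(lra)).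
  rewrite ln_Rinv in H1, H2 by lra.
  replace (5 / 3) with ((5 / 2) / (3 / 2)) in H2 by lra.
  rewrite ln_div in H2 by lra.
  pose proof ln_5_2_lb as B5; pose proof ln_3_2_ub as B3; pose proof ln_2_bounds as B2.
  assert (H3 : 19 / 10 - 5 / 2 * r <= L) by lra.
  assert (H4 : 49 / 100 + 1 - 5 / 3 * (1 - r) <= l) by lra.
  clear H1 H2.
  assert (r * (49 / 100 + 1 - 5 / 3 * (1 - r)) <= r * l) by (apply Rmult_le_compat_l; lra).
  assert ((1 + r) * (19 / 10 - 5 / 2 * r) <= (1 + r) * L) by (apply Rmult_le_compat_l; lra).
  nra.
Qed.

Lemma cost_bound_middle : 1 / 2 <= r <= 3 / 4 ->
  9 / 10 <= r * l + 9 / 16 * (1 + r) * L.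
Proof.
  intros Hr.
  assert (H1 := L_tan (/ 2) ltac:(lra)).
  assert (H2 := l_tan (/ 2) ltac:(lra)).
  rewrite ln_Rinv in H1, H2 by lra.
  pose proof ln_2_bounds as B2.
  assert (H3 : 169 / 100 - 2 * r <= L) by lra.
  assert (H4 : 69 / 100 + 1 - 2 * (1 - r) <= l) by lra.
  clear H1 H2.
  assert (r * (69 / 100 + 1 - 2 * (1 - r)) <= r * l) by (apply Rmult_le_compat_l; lra).
  assert ((1 + r) * (169 / 100 - 2 * r) <= (1 + r) * L) by (apply Rmult_le_compat_l; lra).
  nra.
Qed.

Lemma cost_bound_large : 3 / 4 <= r -> 1 + 3 / 10 * (1 - r) <= r * l + 9 / 16 * (1 + r) * L.
Proof.
  intros Hr.
  assert (H1 := L_tan 1 ltac:(lra)).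
  assert (H2 := l_tan (/ (2 * 2)) ltac:(lra)).
  rewrite ln_1 in H1. rewrite ln_Rinv, ln_mult in H2 by lra.
  pose proof ln_2_bounds as B2.
  assert (H3 : 1 - r <= L) by lra.
  assert (H4 : 138 / 100 + 1 - 4 * (1 - r) <= l) by lra.
  clear H1 H2.
  assert (r * (138 / 100 + 1 - 4 * (1 - r)) <= r * l) by (apply Rmult_le_compat_l; lra).
  assert ((1 + r) * (1 - r) <= (1 + r) * L) by (apply Rmult_le_compat_l; lra).
  nra.
Qed.

(* With r = t / a and s = t / b, the left-hand side is the net cost of moving the mass from
   the balanced pair at distances (a, b) to the one at distances (t, b). *)
Lemma two_point_cost (s : R) : 0 < s ->
  (r * ln (1 - r) + s * ln (1 + s)) / (r + s) - s / (1 + s) * ln s <= 9 / 16 * - ln r.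
Proof.
  intros Hs. fold L.
  replace (ln (1 - r)) with (- l) by (unfold l; ring).
  pose proof ln_2_bounds as B2.
  assert (L0 : 0 <= L). { generalize (L_tan 1 ltac:(lra)); rewrite ln_1; lra. }
  assert (l0 : 0 <= l). { generalize (l_tan 1 ltac:(lra)); rewrite ln_1; lra. }
  apply Rmult_le_reg_r with (r + s); [lra|].
  replace (((r * - l + s * ln (1 + s)) / (r + s) - s / (1 + s) * ln s) * (r + s))
    with (r * - l + s * ln (1 + s) - (r + s) * (s / (1 + s) * ln s)) by (field; lra).
  destruct (Rle_dec s 1) as [s1 | s1].
  (* For s <= 1 the entropy bound eliminates ln s, and ln(1 + s) >= s/2 makes what remains affine in
     s. It is enough to check s = 0, which is [F0] times r, and s = 1, which is [F1]. *)
  - assert (HE := entropy_le_ln2 s Hs).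
    assert (F0 : ln 2 <= l + 9 / 16 * L).
    { assert (H1 := L_tan (/ 2) ltac:(lra)). assert (H2 := l_tan 1 ltac:(lra)).
      rewrite ln_Rinv in H1 by lra. rewrite ln_1 in H2. lra. }
    assert (F1 : (1 + r) * ln 2 <= r / 2 + r * l + 9 / 16 * (1 + r) * L).
    { destruct (Rle_dec r (1 / 2)); [generalize (cost_bound_small ltac:(lra)); nra|].
      destruct (Rle_dec r (3 / 4)); [generalize (cost_bound_middle ltac:(lra)); nra|].
      generalize (cost_bound_large ltac:(lra)); nra. }
    assert (Hl : s / 2 <= ln (1 + s)).
    { assert (H := ln_le_sub1 (/ (1 + s)) ltac:(apply Rinv_0_lt_compat; lra)).
      rewrite ln_Rinv in H by lra.
      assert (/ (1 + s) = 1 - s / (1 + s)) by (field; lra).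
      assert (s / 2 <= s / (1 + s)).
      { apply Rmult_le_compat_l; [lra|]. apply Rinv_le_contravar; lra. }
      lra. }
    assert ((r + s) * (ln (1 + s) - ln 2) <= (r + s) * (s / (1 + s) * ln s))
      by (apply Rmult_le_compat_l; lra).
    assert (r * (s / 2) <= r * ln (1 + s)) by (apply Rmult_le_compat_l; lra).
    assert ((1 - s) * r * ln 2 <= (1 - s) * r * (l + 9 / 16 * L))
      by (apply Rmult_le_compat_l; [nra | lra]).
    assert (s * ((1 + r) * ln 2) <= s * (r / 2 + r * l + 9 / 16 * (1 + r) * L))
      by (apply Rmult_le_compat_l; lra).
    lra.
  - assert (s1' : 1 < s) by lra.
    set (v := / s).
    assert (v0 : 0 < v) by (apply Rinv_0_lt_compat; lra).
    assert (v1 : v <= 1) by (unfold v; rewrite <- Rinv_1; apply Rinv_le_contravar; lra).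
    assert (sv : s * v = 1) by (unfold v; field; lra).
    assert (E : ln (1 + s) = ln s + ln (1 + v)).
    { rewrite <- ln_mult by lra. f_equal. lra. }
    rewrite E.
    replace (r * - l + s * (ln s + ln (1 + v)) - (r + s) * (s / (1 + s) * ln s))
      with (s * (ln (1 + v) + (1 - r) * (ln s / (1 + s)) - r * v * l))
      by (unfold v; field; lra).
    assert (Hk : ln s / (1 + s) <= 3 / 10).
    { apply Rle_div_l; [lra|]. apply ln_le_linear; lra. }
    apply Rle_trans with (s * (9 / 16 * (1 + r * v) * L));
      [| right; unfold v; field; lra].
    apply Rmult_le_compat_l; [lra|].
    assert ((1 - r) * (ln s / (1 + s)) <= (1 - r) * (3 / 10)) by (apply Rmult_le_compat_l; lra).
    (* Below, ln (1 + v) is replaced by a tangent, so that everything is affine in v. *)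
    enough (ln (1 + v) + (1 - r) * (3 / 10) <= r * v * l + 9 / 16 * (1 + r * v) * L) by lra.
    assert (aff : forall u w, ln (1 + v) <= u + w * v ->
       u + 3 / 10 * (1 - r) <= 9 / 16 * L ->
       u + w + 3 / 10 * (1 - r) <= r * l + 9 / 16 * (1 + r) * L ->
       ln (1 + v) + (1 - r) * (3 / 10) <= r * v * l + 9 / 16 * (1 + r * v) * L).
    { intros u w h1 h2 h3.
      assert ((1 - v) * (u + 3 / 10 * (1 - r)) <= (1 - v) * (9 / 16 * L))
        by (apply Rmult_le_compat_l; lra).
      assert (v * (u + w + 3 / 10 * (1 - r)) <= v * (r * l + 9 / 16 * (1 + r) * L))
        by (apply Rmult_le_compat_l; lra).
      lra. }
    (* The tangent of ln(1 + v) is taken at v = 1, 1/2 and 0 in the three ranges: as r tends to 1,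
       [L] tends to 0 and the endpoint v = 0 leaves less and less room for the constant term u. *)
    destruct (Rle_dec r (1 / 2)); [|destruct (Rle_dec r (3 / 4))].
    + apply aff with (ln 2 - 1 / 2) (1 / 2).
      * generalize (ln_le_tangent 2 (1 + v) ltac:(lra) ltac:(lra)); lra.
      * assert (H1 := L_tan (/ 2) ltac:(lra)). rewrite ln_Rinv in H1 by lra. lra.
      * generalize (cost_bound_small ltac:(lra)); lra.
    + pose proof ln_3_2_ub as B3.
      apply aff with (ln (3 / 2) - 1 / 3) (2 / 3).
      * generalize (ln_le_tangent (3 / 2) (1 + v) ltac:(lra) ltac:(lra)); lra.
      * assert (H1 := L_tan (/ (3 / 2)) ltac:(lra)). rewrite ln_Rinv in H1 by lra. lra.
      * generalize (cost_bound_middle ltac:(lra)); lra.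
    + apply aff with 0 1.
      * generalize (ln_le_sub1 (1 + v) ltac:(lra)); lra.
      * assert (H1 := L_tan 1 ltac:(lra)). rewrite ln_1 in H1. lra.
      * generalize (cost_bound_large ltac:(lra)); lra.
Qed.

End RebalancingCost.

(** * The effect of one node on a balanced pair *)

(** The logarithm of the equation for lambda says that the increasing function ln(x - 1) + x
    vanishes at x = exp lambda. *)
Lemma scale_threshold (lambda x : R) :
  exp (exp lambda) * (exp lambda - 1) = 1 -> 1 < x -> x <= exp lambda -> ln (x - 1) + x <= 0.
Proof.
  intros Hl Hx Hxl.
  assert (He : 0 < exp lambda - 1) by lra.
  assert (E : exp lambda + ln (exp lambda - 1) = 0).
  { rewrite <- (ln_exp (exp lambda)) at 1. rewrite <- ln_mult; [|apply exp_pos|lra].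
    rewrite Hl. apply ln_1. }
  assert (ln (x - 1) <= ln (exp lambda - 1)) by (apply ln_le; lra).
  lra.
Qed.

(** Ensures that a move which more than halves the distance to y is long enough to pay for its
    factor 1 / tau. *)
Lemma lambda_le_ln2 (lambda : R) : exp (exp lambda) * (exp lambda - 1) = 1 -> lambda <= ln 2.
Proof.
  intros Hl. rewrite <- (ln_exp lambda). apply ln_le; [apply exp_pos|].
  destruct (Rle_dec (exp lambda) 2) as [|Hn]; [assumption|exfalso].
  generalize (exp_ineq1_le (exp lambda)); intros. nra.
Qed.

(* A unit mass is split between two points at distances a and b on either side of the
   node, with mean at the node; a new point at distance s on the side of the first one
   either does not increase the potential, or rebalancing onto it pays for itself. *)
Lemma balanced_step (lambda a b s : R) :
  exp (exp lambda) * (exp lambda - 1) = 1 ->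
  0 < a -> 0 < b -> 0 < s -> s <> a ->
  let w := b / (a + b) in
  let w' := b / (s + b) in
  let P := w * ln (Rabs (a - s) / s) + (1 - w) * ln ((b + s) / s) in
  P <= 0 \/
  (s < a /\ lambda <= ln (a / s) /\
   P + w * ln (s / a) + (w' - w) * ln (s / b) <= 9 / 16 * ln (a / s)).
Proof.
  intros Hl Ha Hb Hs Hsa w w' P.
  assert (Hw : 0 < w) by (apply Rdiv_lt_0_compat; lra).
  assert (Hw1 : 1 - w = a / (a + b)) by (unfold w; field; lra).
  assert (Hw1' : 0 < 1 - w) by (rewrite Hw1; apply Rdiv_lt_0_compat; lra).
  assert (Hbs : ln ((b + s) / s) <= b / s).
  { replace ((b + s) / s) with (1 + b / s) by (field; lra).
    assert (0 < b / s) by (apply Rdiv_lt_0_compat; lra).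
    generalize (ln_le_sub1 (1 + b / s)); lra. }
  (* This is the condition on the centre of mass. It moves the first-order gain b/s of the far point
     to the other point, so that b disappears from the sign condition [HP]. *)
  assert (Hbal : (1 - w) * (b / s) = w * (a / s)) by (rewrite Hw1; unfold w; field; lra).
  assert (HP : ln (Rabs (a - s) / s) + a / s <= 0 -> P <= 0).
  { intros H. unfold P.
    assert ((1 - w) * ln ((b + s) / s) <= (1 - w) * (b / s)) by (apply Rmult_le_compat_l; lra).
    assert (w * (ln (Rabs (a - s) / s) + a / s) <= w * 0) by (apply Rmult_le_compat_l; lra).
    lra. }
  destruct (Rlt_dec a s) as [Has | Has].
  - left. apply HP. rewrite Rabs_left by lra.
    replace (- (a - s) / s) with (1 - a / s) by (field; lra).
    assert (a / s < 1) by (apply Rlt_div_l; lra).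
    generalize (ln_le_sub1 (1 - a / s)); lra.
  - assert (Hsa' : s < a) by lra.
    assert (1 < a / s) by (apply Rlt_div_r; lra).
    destruct (Rle_dec (a / s) (exp lambda)) as [Hle | Hgt].
    + left. apply HP. rewrite Rabs_right by lra.
      replace ((a - s) / s) with (a / s - 1) by (field; lra).
      apply scale_threshold with lambda; assumption.
    + right. split; [assumption|]. split.
      * rewrite <- (ln_exp lambda). apply ln_le; [apply exp_pos | lra].
      * assert (Hr0 : 0 < s / a) by (apply Rdiv_lt_0_compat; lra).
        assert (Hr1 : s / a < 1) by (apply Rlt_div_l; lra).
        assert (Hsb : 0 < s / b) by (apply Rdiv_lt_0_compat; lra).
        generalize (two_point_cost (s / a) Hr0 Hr1 (s / b) Hsb).
        unfold P. rewrite Rabs_right by lra.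
        replace (ln (1 - s / a)) with (ln (a - s) - ln a)
          by (rewrite <- ln_div by lra; f_equal; field; lra).
        replace (ln (1 + s / b)) with (ln (b + s) - ln b)
          by (rewrite <- ln_div by lra; f_equal; field; lra).
        rewrite !ln_div by lra. intros HQ.
        match goal with |- ?x <= _ => match type of HQ with ?y <= _ =>
          replace x with y; [lra|] end end.
        unfold w, w'. field. repeat split; nra.
Qed.

(** The budget left to a point at distance t from y. The truncation is for points of K that are not
    nodes and may be closer to y than d; wherever a decrease is measured, both distances are at
    least d and the logarithm is exact. *)
Definition log_excess (d t : R) : R := Rmax 0 (ln (t / d)).

Lemma log_excess_nonneg (d t : R) : 0 <= log_excess d t.
Proof. apply Rmax_l. Qed.

Lemma log_excess_ge (d t : R) : 0 < d -> d <= t -> log_excess d t = ln t - ln d.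
Proof.
  intros Hd Ht. unfold log_excess. rewrite ln_div by lra.
  assert (ln d <= ln t) by (apply ln_le; lra). apply Rmax_right; lra.
Qed.

Lemma log_excess_le (d t D : R) : 0 < d -> d <= D -> 0 < t -> t <= D ->
  log_excess d t <= ln (D / d).
Proof.
  intros Hd HdD Ht HtD. unfold log_excess. rewrite !ln_div by lra.
  assert (ln d <= ln D) by (apply ln_le; lra).
  assert (ln t <= ln D) by (apply ln_le; lra).
  apply Rmax_lub; lra.
Qed.

Lemma Rabs_same_side (y p x : R) : 0 < (p - y) * (x - y) ->
  Rabs (p - x) = Rabs (Rabs (p - y) - Rabs (x - y)).
Proof.
  intros H. unfold Rabs.
  repeat match goal with |- context [Rcase_abs ?t] => destruct (Rcase_abs t) end; nra.
Qed.

Lemma Rabs_opposite_side (y p x : R) : (p - y) * (x - y) < 0 ->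
  Rabs (p - x) = Rabs (p - y) + Rabs (x - y).
Proof.
  intros H. unfold Rabs.
  repeat match goal with |- context [Rcase_abs ?t] => destruct (Rcase_abs t) end; nra.
Qed.

(** * Products of distances and the two-point argument *)

Lemma prodR_ext (n : nat) (f g : nat -> R) :
  (forall j, (j < n)%nat -> f j = g j) -> prodR n f = prodR n g.
Proof.
  intros H. induction n as [|n IH]; simpl; [reflexivity|].
  rewrite IH, H by (intros; try apply H; lia). reflexivity.
Qed.

Lemma prodR_mult (n : nat) (f g : nat -> R) :
  prodR n (fun j => f j * g j) = prodR n f * prodR n g.
Proof. induction n as [|n IH]; simpl; [ring|]. rewrite IH; ring. Qed.

Lemma prodR_pos (n : nat) (f : nat -> R) :
  (forall j, (j < n)%nat -> 0 < f j) -> 0 < prodR n f.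
Proof.
  intros H. induction n as [|n IH]; simpl; [lra|].
  apply Rmult_lt_0_compat; [apply IH; intros; apply H; lia | apply H; lia].
Qed.

Lemma prodR_nonneg (n : nat) (f : nat -> R) :
  (forall j, (j < n)%nat -> 0 <= f j) -> 0 <= prodR n f.
Proof.
  intros H. induction n as [|n IH]; simpl; [lra|].
  apply Rmult_le_pos; [apply IH; intros; apply H; lia | apply H; lia].
Qed.

Lemma prodR_le (n : nat) (f g : nat -> R) :
  (forall j, (j < n)%nat -> 0 <= f j <= g j) -> prodR n f <= prodR n g.
Proof.
  intros H. induction n as [|n IH]; simpl; [lra|].
  apply Rmult_le_compat.
  - apply prodR_nonneg. intros j Hj; apply (H j); lia.
  - apply (H n); lia.
  - apply IH. intros; apply H; lia.
  - apply (H n); lia.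
Qed.

Lemma prodR_Rabs (n : nat) (f : nat -> R) : Rabs (prodR n f) = prodR n (fun j => Rabs (f j)).
Proof. induction n as [|n IH]; simpl; [apply Rabs_R1|]. rewrite Rabs_mult, IH; reflexivity. Qed.

Lemma prodR_split (n k : nat) (f : nat -> R) : (k < n)%nat ->
  prodR n f = f k * prodR n (fun j => if Nat.eqb j k then 1 else f j).
Proof.
  intros Hk. induction n as [|n IH]; [lia|]. simpl.
  destruct (Nat.eq_dec n k) as [-> | Hn].
  - rewrite Nat.eqb_refl.
    rewrite (prodR_ext k (fun j => if Nat.eqb j k then 1 else f j) f); [ring|].
    intros j Hj. rewrite (proj2 (Nat.eqb_neq j k)) by lia. reflexivity.
  - rewrite IH by lia. rewrite (proj2 (Nat.eqb_neq n k)) by lia. ring.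
Qed.

Lemma opposite_side_trans (u v t : R) : u * v < 0 -> 0 < u * t -> v * t < 0.
Proof.
  intros Huv Hut. apply Rnot_le_lt; intros Hvt.
  assert (0 <= (u * u) * (v * t)) by (apply Rmult_le_pos; [nra | assumption]).
  assert ((u * v) * (u * t) < 0) by nra.
  lra.
Qed.

Lemma same_side_trans (u v t : R) : u * v < 0 -> u * t < 0 -> 0 < v * t.
Proof.
  intros Huv Hut. apply Rnot_le_lt; intros Hvt.
  assert (0 <= (u * u) * - (v * t)) by (apply Rmult_le_pos; [nra | lra]).
  assert (0 < (u * v) * (u * t)) by nra.
  lra.
Qed.

(** * The bound for one Lagrange basis polynomial *)

Section LagrangeBound.

Variables (K : R -> Prop) (xs : nat -> R) (n k : nat) (lambda tau d D : R).
Hypothesis lambda_pos : 0 < lambda.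
Hypothesis lambda_eq : exp (exp lambda) * (exp lambda - 1) = 1.
Hypothesis tau_pos : 0 < tau.
Hypothesis tau_le1 : tau <= 1.
Hypothesis leja : quasi_Leja K tau n xs.
Hypothesis kn : (k < n)%nat.
Hypothesis d_pos : 0 < d.
Hypothesis dD : d <= D.
Hypothesis sep : forall i j, (i < n)%nat -> (j < n)%nat -> i <> j -> d <= Rabs (xs i - xs j).
Hypothesis diamD : forall x y, K x -> K y -> Rabs (x - y) <= D.

Let y := xs k.
Let c := ln (/ tau).
(** Price of one unit of logarithmic distance: 9/16 for the rebalancing of [balanced_step], and
    c/lambda so that a move of length at least lambda pays for a full factor 1 / tau. *)
Let cost := 9 / 16 + c / lambda.
Let excess := log_excess d.

(** The contribution of the first m nodes to the modulus of the k-th Lagrange polynomial at z, all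
    of it when m = n. Decreasing m undoes the insertion of the nodes. *)
Let ratio (m : nat) (z : R) : R :=
  prodR m (fun j => if Nat.eqb j k then 1 else Rabs (z - xs j) / Rabs (y - xs j)).

Let Ky : K y.
Proof. apply leja; exact kn. Qed.

Let Kxs j : (j < n)%nat -> K (xs j).
Proof. apply leja. Qed.

Let sepy j : (j < n)%nat -> j <> k -> d <= Rabs (xs j - y).
Proof. intros Hj Hjk. apply sep; auto. Qed.

Let c_nonneg : 0 <= c.
Proof.
  unfold c. rewrite <- ln_1. apply ln_le; [lra|]. rewrite <- Rinv_1.
  apply Rinv_le_contravar; lra.
Qed.

Let cl_nonneg : 0 <= c / lambda.
Proof. apply Rle_div_r; lra. Qed.

Let c_le_steps t : lambda <= t -> c <= c / lambda * t.
Proof.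
  intros Ht. apply Rle_trans with (c / lambda * lambda); [right; field; lra|].
  apply Rmult_le_compat_l; [exact cl_nonneg | exact Ht].
Qed.

Let ratio_nonneg m z : (m <= n)%nat -> 0 <= ratio m z.
Proof.
  intros Hm. apply prodR_nonneg. intros j Hj. destruct (Nat.eqb_spec j k); [lra|].
  apply Rmult_le_pos; [apply Rabs_pos|]. apply Rlt_le, Rinv_0_lt_compat.
  rewrite Rabs_minus_sym. generalize (sepy j ltac:(lia) ltac:(assumption)); lra.
Qed.

Let ratio_S m z : (k < m)%nat -> ratio (S m) z = ratio m z * (Rabs (z - xs m) / Rabs (xs m - y)).
Proof.
  intros Hm. unfold ratio; simpl. rewrite (proj2 (Nat.eqb_neq m k)) by lia.
  rewrite (Rabs_minus_sym (xs m) y). reflexivity.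
Qed.

Let ratio_node m : (k < m)%nat -> (m < n)%nat -> 0 < ratio m (xs m).
Proof.
  intros Hk Hm. apply prodR_pos. intros j Hj. destruct (Nat.eqb_spec j k); [lra|].
  apply Rdiv_lt_0_compat.
  - generalize (sep m j ltac:(lia) ltac:(lia) ltac:(lia)); lra.
  - rewrite Rabs_minus_sym. generalize (sepy j ltac:(lia) ltac:(assumption)); lra.
Qed.

Let leja_le m z : (m < n)%nat -> K z ->
  prodR m (fun j => Rabs (z - xs j)) <= / tau * prodR m (fun j => Rabs (xs m - xs j)).
Proof.
  intros Hm Kz.
  assert (1 <= / tau) by (rewrite <- Rinv_1; apply Rinv_le_contravar; lra).
  (* [quasi_Leja] says nothing at index 0, where both products are empty and the claim is 1 <= 1 /
     tau. *)
  destruct m as [|m]; [simpl; lra|].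
  assert (H' := proj2 leja (S m) ltac:(lia) Hm z Kz).
  apply Rmult_le_reg_l with tau; [lra|].
  rewrite <- Rmult_assoc, Rinv_r by lra. lra.
Qed.

(** Start of both inductions: once only the nodes before x_k are left, the denominator is exactly
    the product in the Leja inequality at x_k. *)
Let ratio_Sk z : K z -> ratio (S k) z <= / tau.
Proof.
  intros Kz. unfold ratio; simpl. rewrite Nat.eqb_refl, Rmult_1_r.
  assert (Hp : 0 < prodR k (fun j => Rabs (y - xs j))).
  { apply prodR_pos. intros j Hj. generalize (sep k j kn ltac:(lia) ltac:(lia)). unfold y; lra. }
  apply Rmult_le_reg_r with (prodR k (fun j => Rabs (y - xs j))); [exact Hp|].
  rewrite <- prodR_mult.
  apply Rle_trans with (prodR k (fun j => Rabs (z - xs j))); [right|apply leja_le; auto].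
  apply prodR_ext. intros j Hj. rewrite (proj2 (Nat.eqb_neq j k)) by lia.
  field. generalize (sep k j kn ltac:(lia) ltac:(lia)). unfold y; lra.
Qed.

(** The node y is among those before x_m but is left out of [ratio]; its factor is what makes a move
    towards y profitable, by the quotient of the distances. *)
Let ratio_leja m z : (k < m)%nat -> (m < n)%nat -> K z ->
  Rabs (z - y) * ratio m z <= / tau * (Rabs (xs m - y) * ratio m (xs m)).
Proof.
  intros Hk Hm Kz.
  set (den := prodR m (fun j => if Nat.eqb j k then 1 else Rabs (y - xs j))).
  assert (Hden : 0 < den).
  { apply prodR_pos. intros j Hj. destruct (Nat.eqb_spec j k); [lra|].
    rewrite Rabs_minus_sym. generalize (sepy j ltac:(lia) ltac:(assumption)); lra. }
  assert (E : forall u, prodR m (fun j => Rabs (u - xs j)) = Rabs (u - y) * ratio m u * den).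
  { intros u. rewrite (prodR_split m k) by exact Hk. fold y. rewrite Rmult_assoc. f_equal.
    unfold ratio, den. rewrite <- prodR_mult. apply prodR_ext. intros j Hj.
    destruct (Nat.eqb_spec j k); [ring|]. field.
    rewrite Rabs_minus_sym. generalize (sepy j ltac:(lia) ltac:(assumption)); lra. }
  generalize (leja_le m z Hm Kz). rewrite !E. intros Hle.
  apply Rmult_le_reg_r with den; [exact Hden|]. lra.
Qed.

Let ln_ratio_leja m z : (k < m)%nat -> (m < n)%nat -> K z -> 0 < Rabs (z - y) ->
  0 < ratio m z ->
  ln (ratio m z) <= c + ln (ratio m (xs m)) + ln (Rabs (xs m - y) / Rabs (z - y)).
Proof.
  intros Hk Hm Kz Hz Hr.
  assert (Hs := sepy m Hm ltac:(lia)).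
  assert (Hnode := ratio_node m Hk Hm).
  assert (Ht : 0 < / tau) by (apply Rinv_0_lt_compat; lra).
  generalize (ratio_leja m z Hk Hm Kz). intros Hle. apply ln_le in Hle; [|nra].
  rewrite !ln_mult in Hle by nra. fold c in Hle. rewrite ln_div by lra. lra.
Qed.

(** The induction step when x_m lies on the side of p. The induction hypothesis is an explicit
    premise, so that exchanging p and q yields the other case. *)
Let two_point_bound_side m p q :
  (k < m)%nat -> (m < n)%nat -> K p -> K q ->
  (p - y) * (q - y) < 0 -> 0 < (p - y) * (xs m - y) ->
  0 < ratio (S m) p -> 0 < ratio (S m) q ->
  (forall p' q', K p' -> K q' -> (p' - y) * (q' - y) < 0 -> 0 < ratio m p' -> 0 < ratio m q' ->
     (Rabs (q' - y) * ln (ratio m p') + Rabs (p' - y) * ln (ratio m q')) /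
       (Rabs (p' - y) + Rabs (q' - y)) <=
     c + cost * (excess (Rabs (p' - y)) + excess (Rabs (q' - y)))) ->
  (Rabs (q - y) * ln (ratio (S m) p) + Rabs (p - y) * ln (ratio (S m) q)) /
    (Rabs (p - y) + Rabs (q - y)) <=
  c + cost * (excess (Rabs (p - y)) + excess (Rabs (q - y))).
Proof.
  intros Hk Hm Kp Kq Hpq Hps Hrp Hrq IH.
  assert (Hqs : (q - y) * (xs m - y) < 0)
    by (apply opposite_side_trans with (p - y); assumption).
  assert (Hsd := sepy m Hm ltac:(lia)).
  rewrite ratio_S in Hrp, Hrq by lia. rewrite !ratio_S by lia.
  rewrite (Rabs_same_side y p (xs m)) in Hrp |- * by assumption.
  rewrite (Rabs_opposite_side y q (xs m)) in Hrq |- * by assumption.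
  assert (Ha : 0 < Rabs (p - y)) by (apply Rabs_pos_lt; nra).
  assert (Hb : 0 < Rabs (q - y)) by (apply Rabs_pos_lt; nra).
  assert (IHpq := IH p q Kp Kq Hpq).
  assert (Hp' := ln_ratio_leja m p Hk Hm Kp Ha).
  assert (Hq' := ln_ratio_leja m q Hk Hm Kq Hb).
  assert (IHxq := IH (xs m) q (Kxs m Hm) Kq ltac:(lra) (ratio_node m Hk Hm)).
  clear IH.
  assert (Rp0 := ratio_nonneg m p ltac:(lia)). assert (Rq0 := ratio_nonneg m q ltac:(lia)).
  set (a := Rabs (p - y)) in *. set (b := Rabs (q - y)) in *. set (s := Rabs (xs m - y)) in *.
  set (X := ln (ratio m (xs m))) in *.
  assert (Hrp' : 0 < ratio m p).
  { destruct Rp0 as [|E]; [assumption|]. rewrite <- E, Rmult_0_l in Hrp. lra. }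
  assert (Hrq' : 0 < ratio m q).
  { destruct Rq0 as [|E]; [assumption|]. rewrite <- E, Rmult_0_l in Hrq. lra. }
  specialize (IHpq Hrp' Hrq'). specialize (Hp' Hrp'). specialize (Hq' Hrq').
  specialize (IHxq Hrq').
  assert (Hsa : s <> a).
  { intros E. rewrite E, Rminus_diag, Rabs_R0 in Hrp. unfold Rdiv in Hrp. lra. }
  assert (Hfp : 0 < Rabs (a - s) / s).
  { apply Rdiv_lt_0_compat; [apply Rabs_pos_lt; lra | lra]. }
  assert (Hfq : 0 < (b + s) / s) by (apply Rdiv_lt_0_compat; lra).
  rewrite !ln_mult by assumption.
  set (Zp := ln (ratio m p)) in *. set (Y := ln (ratio m q)) in *.
  destruct (balanced_step lambda a b s lambda_eq Ha Hb ltac:(lra) Hsa) as [HP | [Hlt [Hlam HQ]]].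
  - apply Rle_trans with (2 := IHpq).
    replace ((b * (Zp + ln (Rabs (a - s) / s)) + a * (Y + ln ((b + s) / s))) / (a + b))
      with ((b * Zp + a * Y) / (a + b) +
        (b / (a + b) * ln (Rabs (a - s) / s) + (1 - b / (a + b)) * ln ((b + s) / s)))
      by (field; lra).
    lra.
  - set (w := b / (a + b)) in *. set (w' := b / (s + b)) in *.
    assert (Hw : 0 <= w) by (apply Rlt_le, Rdiv_lt_0_compat; lra).
    assert (Hww : w <= w').
    { apply Rmult_le_compat_l; [lra|]. apply Rinv_le_contravar; lra. }
    assert (Hw' : w' <= 1) by (apply Rle_div_l; lra).
    (* The mass w goes from p to x_m, and w' - w from q to x_m, which makes x_m and q with weights
       w' and 1 - w' balanced again. The mass moved is w' <= 1, so the Leja inequality costs at most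
       one c. *)
    replace ((b * (Zp + ln (Rabs (a - s) / s)) + a * (Y + ln ((b + s) / s))) / (a + b))
      with (w * Zp + (w' - w) * Y + (1 - w') * Y +
        (w * ln (Rabs (a - s) / s) + (1 - w) * ln ((b + s) / s)))
      by (unfold w, w'; field; lra).
    replace ((b * X + s * Y) / (s + b)) with (w' * X + (1 - w') * Y) in IHxq
      by (unfold w'; field; lra).
    assert (w * Zp <= w * (c + X + ln (s / a))) by (apply Rmult_le_compat_l; lra).
    assert ((w' - w) * Y <= (w' - w) * (c + X + ln (s / b))) by (apply Rmult_le_compat_l; lra).
    assert (w' * c <= c) by nra.
    assert (Hc := c_le_steps _ Hlam).
    assert (Hex : excess a = excess s + ln (a / s)).
    { unfold excess. rewrite !log_excess_ge by lra. rewrite ln_div by lra. ring. }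
    rewrite Hex.
    replace (cost * (excess s + ln (a / s) + excess b)) with
      (cost * (excess s + excess b) + 9 / 16 * ln (a / s) + c / lambda * ln (a / s))
      by (unfold cost; ring).
    lra.
Qed.

Let two_point_bound m p q :
  (k < m)%nat -> (m <= n)%nat -> K p -> K q -> (p - y) * (q - y) < 0 ->
  0 < ratio m p -> 0 < ratio m q ->
  (Rabs (q - y) * ln (ratio m p) + Rabs (p - y) * ln (ratio m q)) /
    (Rabs (p - y) + Rabs (q - y)) <=
  c + cost * (excess (Rabs (p - y)) + excess (Rabs (q - y))).
Proof.
  revert p q. induction m as [|m IH]; [intros; lia|].
  intros p q Hk Hm Kp Kq Hpq Hrp Hrq.
  assert (Ha : 0 < Rabs (p - y)) by (apply Rabs_pos_lt; nra).
  assert (Hb : 0 < Rabs (q - y)) by (apply Rabs_pos_lt; nra).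
  destruct (Nat.eq_dec m k) as [-> | Hmk].
  - assert (cost_nonneg : 0 <= cost) by (unfold cost; lra).
    assert (Hx := log_excess_nonneg d (Rabs (p - y))).
    assert (Hy := log_excess_nonneg d (Rabs (q - y))).
    fold excess in Hx, Hy.
    assert (ln (ratio (S k) p) <= c) by (apply ln_le; auto).
    assert (ln (ratio (S k) q) <= c) by (apply ln_le; auto).
    assert (0 <= cost * (excess (Rabs (p - y)) + excess (Rabs (q - y))))
      by (apply Rmult_le_pos; lra).
    apply Rle_trans with c; [|lra].
    apply Rle_div_l; [lra|]. nra.
  - assert (Hsd := sepy m ltac:(lia) Hmk).
    assert (Hs : xs m - y <> 0) by (intros E; rewrite E, Rabs_R0 in Hsd; lra).
    assert (IH' := fun p q Kp Kq => IH p q ltac:(lia) ltac:(lia) Kp Kq).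
    destruct (Rlt_dec 0 ((p - y) * (xs m - y))) as [Hside | Hside].
    + apply two_point_bound_side; auto; lia.
    (* Now x_m is on the side of q: the statement is rewritten with p and q exchanged. *)
    + rewrite (Rplus_comm (Rabs (q - y) * _)), (Rplus_comm (Rabs (p - y)) (Rabs (q - y))),
        (Rplus_comm (excess (Rabs (p - y)))).
      assert (Hopp : (p - y) * (xs m - y) < 0).
      { apply Rnot_lt_le in Hside. destruct Hside as [|E]; [assumption|].
        apply Rmult_integral in E. destruct E as [E|E]; [rewrite E, Rabs_R0 in Ha|]; lra. }
      apply two_point_bound_side; auto; [lia | lra |].
      apply same_side_trans with (p - y); assumption.
Qed.

(** A single point can be moved to closer nodes on its own side, paid from its own excess. The first
    node met on the other side ends the induction through [two_point_bound], whose second excess is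
    covered by ln (D / d). *)
Let one_point_bound m p :
  (k < m)%nat -> (m <= n)%nat -> K p -> p <> y -> 0 < ratio m p ->
  ln (ratio m p) <= ln 2 + 2 * c + cost * (ln (D / d) + excess (Rabs (p - y))).
Proof.
  revert p. induction m as [|m IH]; [intros; lia|].
  intros p Hk Hm Kp Hpy Hrp.
  pose proof ln_2_bounds as B2.
  assert (Ha : 0 < Rabs (p - y)) by (apply Rabs_pos_lt; lra).
  assert (cost_nonneg : 0 <= cost) by (unfold cost; lra).
  assert (Hexp := log_excess_nonneg d (Rabs (p - y))). fold excess in Hexp.
  assert (HA : 0 <= ln (D / d)).
  { rewrite ln_div by lra. assert (ln d <= ln D) by (apply ln_le; lra). lra. }
  destruct (Nat.eq_dec m k) as [-> | Hmk].
  - assert (ln (ratio (S k) p) <= c) by (apply ln_le; auto).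
    assert (0 <= cost * (ln (D / d) + excess (Rabs (p - y)))) by (apply Rmult_le_pos; lra).
    lra.
  - assert (Hm' : (m < n)%nat) by lia. assert (Hk' : (k < m)%nat) by lia.
    assert (Hsd := sepy m Hm' Hmk).
    assert (Hs : xs m - y <> 0) by (intros E; rewrite E, Rabs_R0 in Hsd; lra).
    assert (IHp := IH p Hk' ltac:(lia) Kp Hpy).
    assert (IHx := IH (xs m) Hk' ltac:(lia) (Kxs m Hm') ltac:(lra) (ratio_node m Hk' Hm')).
    assert (Hleja := ln_ratio_leja m p Hk' Hm' Kp Ha).
    assert (HsD := diamD (xs m) y (Kxs m Hm') Ky).
    rewrite ratio_S in Hrp |- * by lia.
    assert (Rp0 := ratio_nonneg m p ltac:(lia)).
    assert (Hrp' : 0 < ratio m p).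
    { destruct Rp0 as [|E]; [assumption|]. rewrite <- E, Rmult_0_l in Hrp. lra. }
    specialize (IHp Hrp'). specialize (Hleja Hrp').
    destruct (Rlt_dec 0 ((p - y) * (xs m - y))) as [Hside | Hside].
    + rewrite (Rabs_same_side y p (xs m)) in Hrp |- * by assumption.
      set (a := Rabs (p - y)) in *. set (s := Rabs (xs m - y)) in *.
      assert (Hf : 0 < Rabs (a - s) / s).
      { destruct (Req_dec a s) as [E|E].
        - rewrite E, Rminus_diag, Rabs_R0 in Hrp. unfold Rdiv in Hrp. lra.
        - apply Rdiv_lt_0_compat; [apply Rabs_pos_lt; lra | lra]. }
      rewrite ln_mult by assumption.
      (* If s >= a/2, the factor of x_m is at most 1. Otherwise the whole mass moves to x_m: the
         gain s/a absorbs that factor, and the distance shrinks by more than 2. *)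
      destruct (Rle_dec (a / 2) s) as [Has | Has].
      * assert (ln (Rabs (a - s) / s) <= 0).
        { rewrite <- ln_1. apply ln_le; [exact Hf|]. apply Rle_div_l; [lra|].
          apply Rabs_le; lra. }
        lra.
      * rewrite Rabs_right in * by lra.
        assert (Hle2 : ln ((a - s) / s) + ln (s / a) <= 0).
        { rewrite !ln_div by lra. assert (ln (a - s) <= ln a) by (apply ln_le; lra). lra. }
        assert (Hlam : lambda <= ln (a / s)).
        { apply Rle_trans with (1 := lambda_le_ln2 _ lambda_eq). apply ln_le; [lra|].
          apply Rle_div_r; lra. }
        assert (Hc := c_le_steps _ Hlam).
        assert (Hex : excess a = excess s + ln (a / s)).
        { unfold excess. rewrite !log_excess_ge by lra. rewrite ln_div by lra. ring. }
        rewrite Hex.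
        replace (cost * (ln (D / d) + (excess s + ln (a / s)))) with
          (cost * (ln (D / d) + excess s) + 9 / 16 * ln (a / s) + c / lambda * ln (a / s))
          by (unfold cost; ring).
        assert (0 <= ln (a / s)) by lra.
        lra.
    + assert (Hopp : (p - y) * (xs m - y) < 0).
      { apply Rnot_lt_le in Hside. destruct Hside as [|E]; [assumption|].
        apply Rmult_integral in E. lra. }
      (* The node x_m is itself the partner of p. The Leja inequality replaces the share w of p by
         x_m, which turns the bound on the average into a bound at p; the weight terms and the new
         factor (a + s)/s add up to a binary entropy. *)
      assert (H2 := two_point_bound m p (xs m) Hk' ltac:(lia) Kp (Kxs m Hm') Hopp Hrp'
        (ratio_node m Hk' Hm')).
      rewrite (Rabs_opposite_side y p (xs m)) in Hrp |- * by assumption.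
      set (a := Rabs (p - y)) in *. set (s := Rabs (xs m - y)) in *.
      assert (Hf : 0 < (a + s) / s) by (apply Rdiv_lt_0_compat; lra).
      rewrite ln_mult by assumption.
      assert (Hexs : excess s <= ln (D / d)) by (apply log_excess_le; lra).
      assert (Hent := entropy_le_ln2 (a / s) ltac:(apply Rdiv_lt_0_compat; lra)).
      replace (1 + a / s) with ((a + s) / s) in Hent by (field; lra).
      replace (a / s / ((a + s) / s)) with (a / (a + s)) in Hent by (field; lra).
      set (w := a / (a + s)) in *.
      assert (Hw : 0 <= w <= 1).
      { split; [apply Rlt_le, Rdiv_lt_0_compat; lra | apply Rle_div_l; lra]. }
      replace ((s * ln (ratio m p) + a * ln (ratio m (xs m))) / (a + s))
        with ((1 - w) * ln (ratio m p) + w * ln (ratio m (xs m))) in H2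
        by (unfold w; field; lra).
      assert (Hinv : ln (s / a) = - ln (a / s)) by (rewrite !ln_div by lra; ring).
      rewrite Hinv in Hleja.
      assert (w * ln (ratio m p) <= w * (c + ln (ratio m (xs m)) + - ln (a / s)))
        by (apply Rmult_le_compat_l; lra).
      assert (cost * (excess a + excess s) <= cost * (ln (D / d) + excess a))
        by (apply Rmult_le_compat_l; lra).
      assert (w * c <= c) by nra.
      lra.
Qed.

Lemma lagrange_bound x : K x ->
  Rabs (lagrange n xs k x) <= 2 / tau ^ 2 * Rpower (D / d) (9 / 8 + 2 / lambda * ln (1 / tau)).
Proof.
  intros Kx.
  assert (HA : 0 <= ln (D / d)).
  { rewrite ln_div by lra. assert (ln d <= ln D) by (apply ln_le; lra). lra. }
  assert (Hexp : 2 / tau ^ 2 * Rpower (D / d) (9 / 8 + 2 / lambda * ln (1 / tau)) =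
    exp (ln 2 + 2 * c + cost * (ln (D / d) + ln (D / d)))).
  { replace (ln 2 + 2 * c + cost * (ln (D / d) + ln (D / d))) with
      (ln 2 + (c + c) + (9 / 8 + 2 / lambda * ln (1 / tau)) * ln (D / d)).
    - rewrite !exp_plus, exp_ln by lra. unfold c.
      rewrite exp_ln by (apply Rinv_0_lt_compat; lra). unfold Rpower. field; lra.
    - unfold cost, c. unfold Rdiv at 3. rewrite Rmult_1_l. field; lra. }
  assert (E : Rabs (lagrange n xs k x) = ratio n x).
  { unfold lagrange, ratio. rewrite prodR_Rabs. apply prodR_ext. intros j Hj.
    destruct (Nat.eqb_spec j k); [apply Rabs_R1|]. apply Rabs_div.
    assert (Hd := sepy j Hj ltac:(assumption)). intros E. change (y - xs j = 0) in E.
    rewrite Rabs_minus_sym, E, Rabs_R0 in Hd. lra. }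
  rewrite E, Hexp.
  pose proof ln_2_bounds as B2.
  assert (cost_nonneg : 0 <= cost) by (unfold cost; lra).
  assert (0 <= cost * (ln (D / d) + ln (D / d))) by (apply Rmult_le_pos; lra).
  (* The product vanishes at the other nodes, where its logarithm carries no information; the point
     y itself, where it equals 1, is also set apart. *)
  destruct (ratio_nonneg n x ltac:(lia)) as [Hr | Hr].
  - destruct (Req_dec x y) as [-> | Hxy].
    + apply Rle_trans with 1.
      * right. unfold ratio. transitivity (prodR n (fun _ => 1)).
        -- apply prodR_ext. intros j Hj. destruct (Nat.eqb_spec j k); [reflexivity|].
           apply Rinv_r. assert (Hd := sepy j Hj ltac:(assumption)).
           rewrite Rabs_minus_sym; lra.
        -- clear. induction n; simpl; [reflexivity|]. rewrite IHn0; ring.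
      * apply Rle_trans with (2 := exp_ineq1_le _). lra.
    + rewrite <- (exp_ln (ratio n x)) by assumption.
      assert (Hb := one_point_bound n x kn ltac:(lia) Kx Hxy Hr).
      assert (Hex : excess (Rabs (x - y)) <= ln (D / d)).
      { apply log_excess_le; auto. apply Rabs_pos_lt; lra. }
      assert (cost * (ln (D / d) + excess (Rabs (x - y))) <= cost * (ln (D / d) + ln (D / d)))
        by (apply Rmult_le_compat_l; lra).
      apply Rnot_lt_le. intros Hlt. apply exp_lt_inv in Hlt. lra.
  - rewrite <- Hr. left; apply exp_pos.
Qed.

End LagrangeBound.

(** * The maximum principle *)

(** Compactness for a local property with a parameter that may be decreased. For [rectangle_max] it
    gives both the boundedness of f, with [f x y <= / d], and a uniform gap below a supremum that is
    not attained. *)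
Lemma rectangle_compactness (a b a' b' : R) (Q : R -> R -> R -> Prop) :
  (forall d d' x y, 0 < d -> d <= d' -> Q d' x y -> Q d x y) ->
  (forall u v, a <= u <= b -> a' <= v <= b' -> exists d, 0 < d /\
     forall x y, Rabs (x - u) < d -> Rabs (y - v) < d -> Q d x y) ->
  exists d, 0 < d /\ forall x y, a <= x <= b -> a' <= y <= b' -> Q d x y.
Proof.
  intros Hmono Hloc.
  assert (H : forall uv : R * R, exists d : posreal, a <= fst uv <= b -> a' <= snd uv <= b' ->
    forall x y, Rabs (x - fst uv) < d -> Rabs (y - snd uv) < d -> Q d x y).
  { intros [u v]; simpl.
    (* The radius must be defined at every point of the plane; outside the rectangle it is set to
       1. *)
    destruct (classic (a <= u <= b /\ a' <= v <= b')) as [[Hu Hv] | Hn].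
    - destruct (Hloc u v Hu Hv) as [d [Hd HQ]]. exists (mkposreal d Hd). intros _ _. exact HQ.
    - exists (mkposreal 1 Rlt_0_1). intros Hu Hv. tauto. }
  set (delta := fun uv => proj1_sig (constructive_indefinite_description _ (H uv))).
  assert (Hdelta := fun uv => proj2_sig (constructive_indefinite_description _ (H uv))).
  destruct (compactness_value_2d a b a' b' (fun u v => delta (u, v))) as [d Hd].
  exists d. split; [apply cond_pos|]. intros x y Hx Hy.
  apply NNPP. intros HnQ. apply (Hd x y Hx Hy).
  intros [u [v [Hu [Hv [Hxu [Hyv Hle]]]]]]. apply HnQ.
  apply Hmono with (delta (u, v)); [apply cond_pos | exact Hle |].
  exact (Hdelta (u, v) Hu Hv x y Hxu Hyv).
Qed.

Lemma rectangle_max (f : R -> R -> R) (a b a' b' : R) :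
  a <= b -> a' <= b' ->
  (forall x y, a <= x <= b -> a' <= y <= b' -> continuity_2d_pt f x y) ->
  exists x0 y0, a <= x0 <= b /\ a' <= y0 <= b' /\
    forall x y, a <= x <= b -> a' <= y <= b' -> f x y <= f x0 y0.
Proof.
  intros Hab Hab' Hf.
  destruct (rectangle_compactness a b a' b' (fun d x y => f x y <= / d)) as [d [Hd HB]].
  { intros d d' x y Hd Hdd H. apply Rle_trans with (1 := H). apply Rinv_le_contravar; lra. }
  { intros u v Hu Hv. destruct (Hf u v Hu Hv (mkposreal 1 Rlt_0_1)) as [e He]. simpl in He.
    assert (H0 : 0 < / (Rabs (f u v) + 1)).
    { apply Rinv_0_lt_compat. generalize (Rabs_pos (f u v)); lra. }
    exists (Rmin e (/ (Rabs (f u v) + 1))). split; [apply Rmin_pos; [apply cond_pos | exact H0]|].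
    intros x y Hx Hy.
    assert (H1 := He x y (Rlt_le_trans _ _ _ Hx (Rmin_l _ _)) (Rlt_le_trans _ _ _ Hy (Rmin_l _ _))).
    apply Rle_trans with (Rabs (f u v) + 1).
    - apply Rabs_def2 in H1. generalize (Rle_abs (f u v)); lra.
    - apply Rle_trans with (/ / (Rabs (f u v) + 1)); [right; rewrite Rinv_inv; reflexivity|].
      apply Rinv_le_contravar; [|apply Rmin_r].
      apply Rmin_pos; [apply cond_pos | exact H0]. }
  set (E := fun t => exists x y, a <= x <= b /\ a' <= y <= b' /\ t = f x y).
  destruct (completeness E) as [M [HM1 HM2]].
  { exists (/ d). intros t [x [y [Hx [Hy ->]]]]. auto. }
  { exists (f a a'), a, a'. repeat split; lra. }
  apply NNPP. intros Hno.
  assert (Hlt : forall x y, a <= x <= b -> a' <= y <= b' -> f x y < M).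
  { intros x y Hx Hy. destruct (HM1 (f x y)) as [H|H]; [exists x, y; auto | exact H |].
    exfalso. apply Hno. exists x, y. split; [exact Hx|split; [exact Hy|]]. intros u v Hu Hv.
    rewrite H. apply HM1. exists u, v; auto. }
  destruct (rectangle_compactness a b a' b' (fun d x y => d <= M - f x y)) as [e [He Hgap]].
  { intros; lra. }
  { intros u v Hu Hv. assert (Huv := Hlt u v Hu Hv).
    assert (H0 : 0 < (M - f u v) / 2) by lra.
    destruct (Hf u v Hu Hv (mkposreal _ H0)) as [e He]. simpl in He.
    exists (Rmin e ((M - f u v) / 2)). split; [apply Rmin_pos; [apply cond_pos | exact H0]|].
    intros x y Hx Hy.
    assert (H1 := He x y (Rlt_le_trans _ _ _ Hx (Rmin_l _ _)) (Rlt_le_trans _ _ _ Hy (Rmin_l _ _))).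
    apply Rabs_def2 in H1. generalize (Rmin_r e ((M - f u v) / 2)); lra. }
  assert (M <= M - e); [|lra].
  apply HM2. intros t [x [y [Hx [Hy ->]]]]. generalize (Hgap x y Hx Hy); lra.
Qed.

(** If l > 0, then f' lies above f' x just to the right of x and below it just to the left.
    According to the sign of f' x, the mean value theorem makes f exceed f x on the right or on the
    left. *)
Lemma second_derivative_local_max (f f' : R -> R) (x l e : R) :
  0 < e -> (forall t, Rabs (t - x) < e -> is_derive f t (f' t)) -> is_derive f' x l ->
  (forall t, Rabs (t - x) < e -> f t <= f x) -> l <= 0.
Proof.
  intros He Hf Hf' Hmax. apply Rnot_lt_le. intros Hl.
  apply is_derive_Reals in Hf'. destruct (Hf' l Hl) as [d Hd].
  assert (Hd0 := cond_pos d).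
  set (h := Rmin d e / 2).
  assert (Hm : 0 < Rmin d e) by (apply Rmin_pos; assumption).
  assert (Hde := Rmin_l d e). assert (Hee := Rmin_r d e).
  assert (Hslope : forall t, t <> x -> Rabs (t - x) < d -> 0 < (f' t - f' x) / (t - x)).
  { intros t Ht Htd. generalize (Hd (t - x) ltac:(lra) Htd).
    replace (x + (t - x)) with t by ring. intros H. apply Rabs_def2 in H. lra. }
  destruct (Rle_dec 0 (f' x)) as [Hs | Hs].
  - destruct (MVT_cor2 f f' x (x + h)) as [t [Ht1 Ht2]]; [unfold h; lra | |].
    { intros t Ht. apply is_derive_Reals, Hf. apply Rabs_def1; unfold h in *; lra. }
    assert (H := Hslope t ltac:(lra) ltac:(apply Rabs_def1; unfold h in *; lra)).
    apply (Rmult_lt_compat_r (t - x)) in H; [|lra].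
    replace ((f' t - f' x) / (t - x) * (t - x)) with (f' t - f' x) in H by (field; lra).
    assert (Hle := Hmax (x + h) ltac:(apply Rabs_def1; unfold h in *; lra)).
    assert (0 < f' t * (x + h - x)) by (apply Rmult_lt_0_compat; unfold h in *; lra).
    lra.
  - destruct (MVT_cor2 f f' (x - h) x) as [t [Ht1 Ht2]]; [unfold h; lra | |].
    { intros t Ht. apply is_derive_Reals, Hf. apply Rabs_def1; unfold h in *; lra. }
    assert (H := Hslope t ltac:(lra) ltac:(apply Rabs_def1; unfold h in *; lra)).
    apply (Rmult_lt_compat_r (x - t)) in H; [|lra].
    replace ((f' t - f' x) / (t - x) * (x - t)) with (f' x - f' t) in H by (field; lra).
    assert (Hle := Hmax (x - h) ltac:(apply Rabs_def1; unfold h in *; lra)).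
    assert (0 < - f' t * (x - (x - h))) by (apply Rmult_lt_0_compat; unfold h in *; lra).
    lra.
Qed.

Fixpoint sumR (n : nat) (f : nat -> R) : R :=
  match n with O => 0 | S m => sumR m f + f m end.

Lemma is_derive_sumR (n : nat) (f : nat -> R -> R) (f' : nat -> R) (x : R) :
  (forall j, (j < n)%nat -> is_derive (f j) x (f' j)) ->
  is_derive (fun t => sumR n (fun j => f j t)) x (sumR n f').
Proof.
  intros H. induction n as [|n IH]; simpl; [apply @is_derive_const|].
  apply @is_derive_plus; [apply IH; intros|]; apply H; lia.
Qed.

Lemma sumR_ext (n : nat) (f g : nat -> R) :
  (forall j, (j < n)%nat -> f j = g j) -> sumR n f = sumR n g.
Proof.
  intros H. induction n as [|n IH]; simpl; [reflexivity|].
  rewrite IH, H by (intros; try apply H; lia). reflexivity.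
Qed.

Lemma sumR_plus (n : nat) (f g : nat -> R) :
  sumR n f + sumR n g = sumR n (fun j => f j + g j).
Proof. induction n as [|n IH]; simpl; [ring|]. rewrite <- IH; ring. Qed.

Lemma sumR_0 (n : nat) (f : nat -> R) : (forall j, (j < n)%nat -> f j = 0) -> sumR n f = 0.
Proof.
  intros H. induction n as [|n IH]; simpl; [reflexivity|].
  rewrite IH, H by (intros; try apply H; lia). ring.
Qed.

(** The function is log |z - r| along a line, with s the fixed transverse coordinate; one formula
    serves both partial derivatives. *)
Lemma is_derive_half_log (r s t : R) : 0 < (t - r) ^ 2 + s ^ 2 ->
  is_derive (fun t => / 2 * ln ((t - r) ^ 2 + s ^ 2)) t ((t - r) / ((t - r) ^ 2 + s ^ 2)).
Proof. intros H. auto_derive; [simpl in *; lra|]. field. simpl in *; lra. Qed.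

Lemma is_derive2_half_log (r s t : R) : 0 < (t - r) ^ 2 + s ^ 2 ->
  is_derive (fun t => (t - r) / ((t - r) ^ 2 + s ^ 2)) t
    ((s ^ 2 - (t - r) ^ 2) / ((t - r) ^ 2 + s ^ 2) ^ 2).
Proof. intros H. auto_derive; [simpl in *; lra|]. field. simpl in *; lra. Qed.

Lemma not_inK_open (K : R -> Prop) (x0 y0 : R) : closed_set K -> ~ inK K (x0, y0) ->
  exists e, 0 < e /\ forall x y, Rabs (x - x0) < e -> Rabs (y - y0) < e -> ~ inK K (x, y).
Proof.
  intros HK H0. unfold inK in *; simpl in *.
  destruct (Req_dec y0 0) as [-> | Hy].
  - destruct (HK x0) as [e He]; [intros Kx; apply H0; auto|].
    exists e. split; [apply cond_pos|]. intros x y Hx _ [_ Kx]. exact (He x Hx Kx).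
  - exists (Rabs y0). split; [apply Rabs_pos_lt; exact Hy|]. intros x y _ Hyy [-> _].
    rewrite Rminus_0_l, Rabs_Ropp in Hyy. lra.
Qed.

Lemma sq_dist_pos (K : R -> Prop) (x y r : R) : K r -> ~ inK K (x, y) -> 0 < (x - r) ^ 2 + y ^ 2.
Proof.
  intros Kr H. assert (0 <= (x - r) ^ 2) by apply pow2_ge_0. assert (0 <= y ^ 2) by apply pow2_ge_0.
  apply Rnot_le_lt. intros Hle. apply H. split; simpl.
  - apply Rsqr_0_uniq. unfold Rsqr. simpl in *. lra.
  - replace x with r; [exact Kr|].
    apply Rminus_diag_uniq_sym, Rsqr_0_uniq. unfold Rsqr. simpl in *. lra.
Qed.

(* The term eta * |z|^2 makes the Laplacian equal to 4 * eta off K. *)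
Lemma no_interior_max (K : R -> Prop) (g : C -> R) (r : nat -> R) (n : nat)
    (kappa eta x0 y0 e : R) :
  closed_set K -> harmonic_on (fun z => ~ inK K z) g ->
  (forall j, (j < n)%nat -> K (r j)) -> 0 < eta -> ~ inK K (x0, y0) -> 0 < e ->
  let v x y := sumR n (fun j => / 2 * ln ((x - r j) ^ 2 + y ^ 2)) - kappa * g (x, y)
                 + eta * (x ^ 2 + y ^ 2) in
  ~ (forall x y, ~ inK K (x, y) -> Rabs (x - x0) < e -> Rabs (y - y0) < e -> v x y <= v x0 y0).
Proof.
  intros HK Hg Hr Heta H0 He v Hmax.
  destruct (not_inK_open K x0 y0 HK H0) as [e1 [He1 Hout]].
  set (e2 := Rmin e e1).
  assert (He2 : 0 < e2) by (apply Rmin_pos; assumption).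
  assert (Hx0 : Rabs (x0 - x0) < e2) by (rewrite Rminus_diag, Rabs_R0; exact He2).
  assert (Hy0 : Rabs (y0 - y0) < e2) by (rewrite Rminus_diag, Rabs_R0; exact He2).
  assert (Hnear : forall x y, Rabs (x - x0) < e2 -> Rabs (y - y0) < e2 -> ~ inK K (x, y)).
  { intros x y Hx Hy. apply Hout; eapply Rlt_le_trans; eauto; apply Rmin_r. }
  assert (Hm : forall x y, Rabs (x - x0) < e2 -> Rabs (y - y0) < e2 -> v x y <= v x0 y0).
  { intros x y Hx Hy. apply Hmax; auto; eapply Rlt_le_trans; eauto; apply Rmin_l. }
  assert (Hpos : forall x y j, (j < n)%nat -> Rabs (x - x0) < e2 -> Rabs (y - y0) < e2 ->
    0 < (x - r j) ^ 2 + y ^ 2).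
  { intros x y j Hj Hx Hy. apply sq_dist_pos with K; auto. }
  assert (Hlx : sumR n (fun j => (y0 ^ 2 - (x0 - r j) ^ 2) / ((x0 - r j) ^ 2 + y0 ^ 2) ^ 2)
      - kappa * px (px g) (x0, y0) + 2 * eta <= 0).
  { apply second_derivative_local_max with (f := fun t => v t y0)
      (f' := fun t => sumR n (fun j => (t - r j) / ((t - r j) ^ 2 + y0 ^ 2))
                - kappa * px g (t, y0) + 2 * eta * t) (x := x0) (e := e2); auto.
    - intros t Ht. unfold v. apply @is_derive_plus; [apply @is_derive_minus|].
      + apply is_derive_sumR with (f' := fun j => (t - r j) / ((t - r j) ^ 2 + y0 ^ 2)).
        intros j Hj. apply is_derive_half_log. auto.
      + apply @is_derive_scal. apply (Derive_correct (fun t => g (t, y0))).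
        exact (proj1 (Hg (t, y0) (Hnear t y0 Ht Hy0))).
      + auto_derive; [trivial|]. ring.
    - apply @is_derive_plus; [apply @is_derive_minus|].
      + apply is_derive_sumR with
          (f' := fun j => (y0 ^ 2 - (x0 - r j) ^ 2) / ((x0 - r j) ^ 2 + y0 ^ 2) ^ 2).
        intros j Hj. apply is_derive2_half_log. auto.
      + apply @is_derive_scal. apply (Derive_correct (fun t => px g (t, y0))).
        exact (proj1 (proj2 (proj2 (Hg (x0, y0) H0)))).
      + auto_derive; [trivial|]. ring. }
  (* In the vertical direction the coordinates exchange their roles: the centre is 0 and the
     transverse coordinate is x0 - r j, hence the terms y0 - 0. *)
  assert (Hly :
      sumR n (fun j => ((x0 - r j) ^ 2 - (y0 - 0) ^ 2) / ((y0 - 0) ^ 2 + (x0 - r j) ^ 2) ^ 2)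
      - kappa * py (py g) (x0, y0) + 2 * eta <= 0).
  { assert (Hpos' : forall t j, (j < n)%nat -> Rabs (t - y0) < e2 ->
      0 < (t - 0) ^ 2 + (x0 - r j) ^ 2).
    { intros t j Hj Ht. rewrite Rminus_0_r, Rplus_comm. auto. }
    apply second_derivative_local_max with
      (f := fun t => sumR n (fun j => / 2 * ln ((t - 0) ^ 2 + (x0 - r j) ^ 2)) - kappa * g (x0, t)
                 + eta * (x0 ^ 2 + t ^ 2))
      (f' := fun t => sumR n (fun j => (t - 0) / ((t - 0) ^ 2 + (x0 - r j) ^ 2))
                - kappa * py g (x0, t) + 2 * eta * t) (x := y0) (e := e2); auto.
    - intros t Ht. apply @is_derive_plus; [apply @is_derive_minus|].
      + apply is_derive_sumR with (f' := fun j => (t - 0) / ((t - 0) ^ 2 + (x0 - r j) ^ 2)).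
        intros j Hj. apply is_derive_half_log. auto.
      + apply @is_derive_scal. apply (Derive_correct (fun t => g (x0, t))).
        exact (proj1 (proj2 (Hg (x0, t) (Hnear x0 t Hx0 Ht)))).
      + auto_derive; [trivial|]. ring.
    - apply @is_derive_plus; [apply @is_derive_minus|].
      + apply is_derive_sumR with
          (f' := fun j => ((x0 - r j) ^ 2 - (y0 - 0) ^ 2) / ((y0 - 0) ^ 2 + (x0 - r j) ^ 2) ^ 2).
        intros j Hj. apply is_derive2_half_log. auto.
      + apply @is_derive_scal. apply (Derive_correct (fun t => py g (x0, t))).
        destruct (Hg (x0, y0) H0) as (_ & _ & _ & _ & _ & H & _). exact H.
      + auto_derive; [trivial|]. ring.
    - intros t Ht.
      assert (E : forall t, sumR n (fun j => / 2 * ln ((t - 0) ^ 2 + (x0 - r j) ^ 2)) =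
        sumR n (fun j => / 2 * ln ((x0 - r j) ^ 2 + t ^ 2))).
      { intros u. apply sumR_ext. intros j _. do 2 f_equal. ring. }
      rewrite !E. exact (Hm x0 t Hx0 Ht). }
  destruct (Hg (x0, y0) H0) as (_ & _ & _ & _ & _ & _ & _ & _ & _ & _ & _ & _ & _ & Hlap).
  assert (Hsum : sumR n (fun j => (y0 ^ 2 - (x0 - r j) ^ 2) / ((x0 - r j) ^ 2 + y0 ^ 2) ^ 2) +
    sumR n (fun j => ((x0 - r j) ^ 2 - (y0 - 0) ^ 2) / ((y0 - 0) ^ 2 + (x0 - r j) ^ 2) ^ 2) = 0).
  { rewrite sumR_plus. apply sumR_0. intros j Hj.
    assert (H := Hpos x0 y0 j Hj Hx0 Hy0). simpl in H. field. simpl; lra. }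
  assert (kappa * (px (px g) (x0, y0) + py (py g) (x0, y0)) = 0) by (rewrite Hlap; ring).
  lra.
Qed.

Definition dist2 (x y r : R) : R := sqrt ((x - r) ^ 2 + y ^ 2).

Lemma dist2_nonneg x y r : 0 <= dist2 x y r.
Proof. apply sqrt_pos. Qed.

Lemma dist2_real x r : dist2 x 0 r = Rabs (x - r).
Proof.
  unfold dist2. replace ((x - r) ^ 2 + 0 ^ 2) with (Rsqr (x - r)) by (unfold Rsqr; ring).
  apply sqrt_Rsqr_abs.
Qed.

Lemma dist2_Cmod x y r : dist2 x y r = Cmod (Cminus (x, y) (RtoC r)).
Proof. unfold dist2, Cmod. simpl. f_equal. ring. Qed.

Lemma continuity_2d_dist2 r x y : continuity_2d_pt (fun u v => dist2 u v r) x y.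
Proof.
  unfold dist2. apply (continuity_1d_2d_pt_comp sqrt (fun u v => (u - r) ^ 2 + v ^ 2)).
  - apply continuity_pt_sqrt. generalize (pow2_ge_0 (x - r)) (pow2_ge_0 y); lra.
  - apply continuity_2d_pt_ext with (fun u v => (u - r) * (u - r) + v * v); [intros; ring|].
    assert (H : continuity_2d_pt (fun u v : R => u - r) x y).
    { apply continuity_2d_pt_minus; [apply continuity_2d_pt_id1 | apply continuity_2d_pt_const]. }
    apply continuity_2d_pt_plus; apply continuity_2d_pt_mult; auto; apply continuity_2d_pt_id2.
Qed.

Lemma continuity_2d_prodR n (f : nat -> R -> R -> R) x y :
  (forall j, continuity_2d_pt (f j) x y) ->
  continuity_2d_pt (fun u v => prodR n (fun j => f j u v)) x y.
Proof.
  intros H. induction n as [|n IH]; simpl; [apply continuity_2d_pt_const|].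
  apply continuity_2d_pt_mult; auto.
Qed.

Lemma Cmod_le_abs x y : Cmod (x, y) <= Rabs x + Rabs y.
Proof.
  unfold Cmod; simpl. rewrite <- (sqrt_Rsqr (Rabs x + Rabs y)).
  - apply sqrt_le_1_alt. unfold Rsqr.
    assert (x * x = Rabs x * Rabs x) by (rewrite <- Rabs_mult, Rabs_right; [ring | nra]).
    assert (y * y = Rabs y * Rabs y) by (rewrite <- Rabs_mult, Rabs_right; [ring | nra]).
    generalize (Rabs_pos x) (Rabs_pos y); nra.
  - generalize (Rabs_pos x) (Rabs_pos y); lra.
Qed.

Lemma contC_continuity_2d (g : C -> R) x y : contC g (x, y) ->
  continuity_2d_pt (fun u v => g (u, v)) x y.
Proof.
  intros H eps. destruct (H eps (cond_pos eps)) as [d [Hd H']].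
  assert (Hd2 : 0 < d / 2) by lra.
  exists (mkposreal _ Hd2). simpl. intros u v Hu Hv. apply H'.
  apply Rle_lt_trans with (1 := Cmod_le_abs _ _). simpl. unfold Rminus in *. lra.
Qed.

Lemma prod_dist2_exp n (r : nat -> R) x y :
  (forall j, (j < n)%nat -> 0 < (x - r j) ^ 2 + y ^ 2) ->
  prodR n (fun j => dist2 x y (r j)) = exp (sumR n (fun j => / 2 * ln ((x - r j) ^ 2 + y ^ 2))).
Proof.
  intros H. induction n as [|n IH]; cbn [prodR sumR]; [symmetry; apply exp_0|].
  rewrite exp_plus, <- IH by (intros; apply H; lia). f_equal.
  unfold dist2. rewrite <- Rpower_sqrt by (apply H; lia). reflexivity.
Qed.

(** * The Bernstein-Walsh inequality *)

Lemma compact_Rabs_bound (K : R -> Prop) : compact K -> exists rho, forall x, K x -> Rabs x <= rho.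
Proof.
  intros HK. destruct (compact_P1 K HK) as [m [M H]].
  exists (Rmax (Rabs m) (Rabs M)). intros x Kx. destruct (H x Kx) as [Hm HM].
  generalize (Rmax_l (Rabs m) (Rabs M)) (Rmax_r (Rabs m) (Rabs M)).
  unfold Rabs in *. repeat destruct Rcase_abs; lra.
Qed.

Lemma prodR_const (n : nat) (a : R) : prodR n (fun _ => a) = a ^ n.
Proof. induction n as [|n IH]; simpl; [reflexivity|]. rewrite IH; ring. Qed.

Lemma pow_exp (n : nat) (x : R) : exp x ^ n = exp (INR n * x).
Proof.
  induction n as [|n IH]; [simpl; rewrite Rmult_0_l, exp_0; reflexivity|].
  rewrite S_INR, Rmult_plus_distr_r, Rmult_1_l, exp_plus, <- IH. simpl; ring.
Qed.

(* The extra eps in the exponent forces decay at infinity. *)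
Lemma small_at_infinity (K : R -> Prop) (g : C -> R) (r : nat -> R) (m : nat) (eps M1 : R) :
  compact K -> green_inf K g -> (forall j, (j < m)%nat -> K (r j)) -> 0 < eps -> 0 < M1 ->
  exists R1, 0 < R1 /\ forall x y, R1 <= Cmod (x, y) ->
    prodR m (fun j => dist2 x y (r j)) * exp (- (INR m + eps) * g (x, y)) <= M1.
Proof.
  intros HK [_ [_ [M0 [R0 Hinf]]]] Hr Heps HM1.
  destruct (compact_Rabs_bound K HK) as [rho Hrho].
  assert (Hm := pos_INR m).
  set (L := (INR m * ln 2 + (INR m + eps) * M0 - ln M1) / eps).
  exists (Rmax (Rmax R0 rho) (exp L)).
  split; [apply Rlt_le_trans with (2 := Rmax_r _ _); apply exp_pos|].
  intros x y Hz.
  assert (HL : exp L <= Cmod (x, y)) by (apply Rle_trans with (2 := Hz), Rmax_r).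
  assert (HR0 : R0 <= Cmod (x, y)).
  { apply Rle_trans with (2 := Hz). apply Rle_trans with (2 := Rmax_l _ _), Rmax_l. }
  assert (Hrh : rho <= Cmod (x, y)).
  { apply Rle_trans with (2 := Hz). apply Rle_trans with (2 := Rmax_l _ _), Rmax_r. }
  set (t := Cmod (x, y)) in *.
  assert (Ht : 0 < t) by (apply Rlt_le_trans with (2 := HL), exp_pos).
  assert (HlnL : L <= ln t) by (rewrite <- (ln_exp L); apply ln_le; [apply exp_pos | exact HL]).
  assert (Hg := Hinf (x, y) HR0). fold t in Hg. apply Rabs_le_between in Hg.
  assert (Hp : prodR m (fun j => dist2 x y (r j)) <= exp (INR m * (ln 2 + ln t))).
  { rewrite <- pow_exp, <- prodR_const. apply prodR_le. intros j Hj. split; [apply dist2_nonneg|].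
    rewrite <- ln_mult, exp_ln by lra. rewrite dist2_Cmod.
    apply Rle_trans with (1 := Cmod_triangle _ _).
    rewrite Cmod_opp, Cmod_R. generalize (Hrho _ (Hr j Hj)). fold t. lra. }
  apply Rle_trans with (exp (INR m * (ln 2 + ln t)) * exp (- (INR m + eps) * g (x, y))).
  - apply Rmult_le_compat_r; [apply Rlt_le, exp_pos | exact Hp].
  - rewrite <- exp_plus. rewrite <- (exp_ln M1) by exact HM1.
    apply Rnot_lt_le. intros Hlt. apply exp_lt_inv in Hlt.
    assert (H1 : (INR m + eps) * (ln t - M0) <= (INR m + eps) * g (x, y))
      by (apply Rmult_le_compat_l; lra).
    assert (H2 : eps * L <= eps * ln t) by (apply Rmult_le_compat_l; lra).
    replace (eps * L) with (INR m * ln 2 + (INR m + eps) * M0 - ln M1) in H2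
      by (unfold L; field; lra).
    lra.
Qed.

(** The maximum principle is applied to [V], the modulus of the polynomial times exp(-kappa g).
    Maximization is done before taking logarithms, so that the zeros of the polynomial cause no
    trouble; at the maximizer, off K, the logarithm is smooth. *)
Lemma bernstein_walsh_eps (K : R -> Prop) (g : C -> R) (r : nat -> R) (m : nat) (M eps x1 y1 : R) :
  compact K -> green_inf K g -> (forall z, contC g z) -> (forall j, (j < m)%nat -> K (r j)) ->
  0 <= M -> (forall x, K x -> prodR m (fun j => Rabs (x - r j)) <= M) -> 0 < eps ->
  prodR m (fun j => dist2 x1 y1 (r j)) <= M * exp ((INR m + eps) * g (x1, y1)).
Proof.
  intros HK Hgreen Hcont Hr HM HKM Heps.
  set (kappa := INR m + eps).
  set (V := fun x y => prodR m (fun j => dist2 x y (r j)) * exp (- kappa * g (x, y))).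
  assert (HV0 : forall x y, 0 <= V x y).
  { intros x y. apply Rmult_le_pos; [|apply Rlt_le, exp_pos].
    apply prodR_nonneg. intros; apply dist2_nonneg. }
  assert (HVK : forall x y, inK K (x, y) -> V x y <= M).
  { intros x y Hin. unfold V. rewrite (proj1 (proj2 Hgreen) (x, y) Hin).
    rewrite Rmult_0_r, exp_0, Rmult_1_r.
    destruct Hin as [Hy Kx]; simpl in Hy, Kx. rewrite Hy.
    rewrite (prodR_ext m _ (fun j => Rabs (x - r j))) by (intros; apply dist2_real). auto. }
  enough (HV1 : V x1 y1 <= M).
  { apply Rle_trans with (V x1 y1 * exp (kappa * g (x1, y1))).
    - right. unfold V. rewrite Rmult_assoc, <- exp_plus.
      replace (- kappa * g (x1, y1) + kappa * g (x1, y1)) with 0 by ring. rewrite exp_0; ring.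
    - apply Rmult_le_compat_r; [apply Rlt_le, exp_pos | exact HV1]. }
  apply Rnot_lt_le. intros Hbig.
  (* A level strictly between the bound on K and the supposed counterexample. It is positive even if
     M = 0, as the estimate at infinity requires. *)
  set (M1 := (M + V x1 y1) / 2).
  assert (HM1 : 0 < M1) by (unfold M1; lra).
  assert (HM1V : M1 < V x1 y1) by (unfold M1; lra).
  destruct (small_at_infinity K g r m eps M1 HK Hgreen Hr Heps HM1) as [R1 [HR1 Hfar]].
  fold kappa in Hfar.
  set (Rr := R1 + Rabs x1 + Rabs y1).
  assert (Hax := Rabs_pos x1). assert (Hay := Rabs_pos y1).
  assert (HRr : 0 < Rr) by (unfold Rr; lra).
  set (ell := ln (V x1 y1 / M1)).
  assert (Hell : 0 < ell).
  { unfold ell. rewrite <- ln_1. apply ln_increasing; [lra|]. apply Rlt_div_r; lra. }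
  (* On the square |z|^2 <= 2 Rr^2, so the perturbation costs at most exp(ell / 2), less than the
     quotient of V x1 y1 by M1. Hence V still exceeds M1 at the maximizer of [W], which keeps it off
     K and inside the disc of radius R1. *)
  set (eta := ell / (4 * Rr ^ 2)).
  assert (HR2 : 0 < Rr ^ 2) by (apply pow_lt; exact HRr).
  assert (Heta : 0 < eta) by (apply Rdiv_lt_0_compat; lra).
  set (W := fun x y => V x y * exp (eta * (x * x + y * y))).
  assert (HWV : forall x y, V x y <= W x y).
  { intros x y. unfold W. rewrite <- (Rmult_1_r (V x y)) at 1.
    apply Rmult_le_compat_l; [apply HV0|]. rewrite <- exp_0 at 1.
    apply Rle_trans with (1 + 0); [rewrite exp_0; lra|].
    apply Rle_trans with (2 := exp_ineq1_le _). apply Rplus_le_compat_l.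
    apply Rmult_le_pos; [lra|]. nra. }
  destruct (rectangle_max W (- Rr) Rr (- Rr) Rr) as [x0 [y0 [Hx0 [Hy0 Hmax]]]]; [lra|lra| |].
  { intros x y _ _. unfold W, V.
    assert (Hg2 := contC_continuity_2d g x y (Hcont (x, y))).
    apply continuity_2d_pt_mult; [apply continuity_2d_pt_mult|].
    - apply (continuity_2d_prodR m (fun j u v => dist2 u v (r j))).
      intros j. apply continuity_2d_dist2.
    - apply (continuity_1d_2d_pt_comp exp (fun u v => - kappa * g (u, v))).
      + apply derivable_continuous, derivable_exp.
      + apply continuity_2d_pt_mult; [apply continuity_2d_pt_const | exact Hg2].
    - apply (continuity_1d_2d_pt_comp exp (fun u v => eta * (u * u + v * v))).
      + apply derivable_continuous, derivable_exp.
      + apply continuity_2d_pt_mult; [apply continuity_2d_pt_const|].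
        apply continuity_2d_pt_plus; apply continuity_2d_pt_mult;
          (apply continuity_2d_pt_id1 || apply continuity_2d_pt_id2). }
  assert (Hx1 : - Rr <= x1 <= Rr)
    by (unfold Rr; generalize (Rle_abs x1) (Rle_abs (- x1)); rewrite Rabs_Ropp; lra).
  assert (Hy1 : - Rr <= y1 <= Rr)
    by (unfold Rr; generalize (Rle_abs y1) (Rle_abs (- y1)); rewrite Rabs_Ropp; lra).
  assert (HW1 : V x1 y1 <= W x0 y0) by (apply Rle_trans with (1 := HWV x1 y1), Hmax; assumption).
  assert (HVM1 : M1 < V x0 y0).
  { apply Rnot_le_lt. intros Hle.
    assert (HE : exp (eta * (x0 * x0 + y0 * y0)) <= exp (ell / 2)).
    { assert (Hsq : x0 * x0 + y0 * y0 <= 2 * Rr ^ 2) by nra.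
      assert (H : eta * (x0 * x0 + y0 * y0) <= ell / 2).
      { replace (ell / 2) with (eta * (2 * Rr ^ 2)) by (unfold eta; field; lra).
        apply Rmult_le_compat_l; lra. }
      destruct H as [H|H]; [left; apply exp_increasing, H | rewrite H; lra]. }
    assert (HE2 : exp (ell / 2) < V x1 y1 / M1).
    { rewrite <- (exp_ln (V x1 y1 / M1)) by (apply Rdiv_lt_0_compat; lra). fold ell.
      apply exp_increasing; lra. }
    assert (W x0 y0 < V x1 y1); [|lra].
    apply Rle_lt_trans with (M1 * exp (ell / 2)).
    - unfold W. apply Rmult_le_compat; auto. apply Rlt_le, exp_pos.
    - apply (Rmult_lt_compat_l M1) in HE2; [|exact HM1].
      replace (M1 * (V x1 y1 / M1)) with (V x1 y1) in HE2 by (field; lra). exact HE2. }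
  assert (Hout : ~ inK K (x0, y0)).
  { intros Hin. generalize (HVK x0 y0 Hin). unfold M1 in *. lra. }
  assert (HC : Cmod (x0, y0) < R1).
  { apply Rnot_le_lt. intros H. generalize (Hfar x0 y0 H). unfold V in HVM1. lra. }
  assert (Hmc := Rmax_Cmod (x0, y0)). simpl in Hmc.
  assert (Hmx := Rmax_l (Rabs x0) (Rabs y0)). assert (Hmy := Rmax_r (Rabs x0) (Rabs y0)).
  set (e := Rr - Rmax (Rabs x0) (Rabs y0)).
  assert (He : 0 < e) by (unfold e, Rr; lra).
  apply (no_interior_max K g r m kappa eta x0 y0 e
    (compact_P2 K HK) (proj1 Hgreen) Hr Heta Hout He).
  assert (HWexp : forall x y, ~ inK K (x, y) -> W x y =
    exp (sumR m (fun j => / 2 * ln ((x - r j) ^ 2 + y ^ 2)) - kappa * g (x, y)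
         + eta * (x ^ 2 + y ^ 2))).
  { intros x y Hxy. unfold W, V. rewrite prod_dist2_exp.
    - rewrite <- !exp_plus. f_equal. ring.
    - intros j Hj. apply sq_dist_pos with K; auto. }
  intros x y Hxy Hxe Hye.
  assert (Hle : W x y <= W x0 y0).
  { apply Hmax; apply Rabs_le_between; unfold e in *.
    - replace x with ((x - x0) + x0) by ring. apply Rle_trans with (1 := Rabs_triang _ _). lra.
    - replace y with ((y - y0) + y0) by ring. apply Rle_trans with (1 := Rabs_triang _ _). lra. }
  rewrite !HWexp in Hle by assumption.
  apply Rnot_lt_le. intros Hlt. apply exp_increasing in Hlt. lra.
Qed.

Lemma bernstein_walsh (K : R -> Prop) (g : C -> R) (r : nat -> R) (m : nat) (M x1 y1 : R) :
  compact K -> green_inf K g -> (forall z, contC g z) -> (forall j, (j < m)%nat -> K (r j)) ->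
  0 <= M -> (forall x, K x -> prodR m (fun j => Rabs (x - r j)) <= M) ->
  prodR m (fun j => dist2 x1 y1 (r j)) <= M * exp (INR m * g (x1, y1)).
Proof.
  intros HK Hgreen Hcont Hr HM HKM.
  assert (H := fun eps => bernstein_walsh_eps K g r m M eps x1 y1 HK Hgreen Hcont Hr HM HKM).
  set (p := prodR m (fun j => dist2 x1 y1 (r j))) in *. set (G := g (x1, y1)) in *.
  apply Rnot_lt_le. intros Hlt.
  (* The limit eps to 0 is taken on logarithms, which requires M > 0; for M = 0 a single value of
     eps is enough. *)
  destruct HM as [HM | <-].
  - assert (Hp : 0 < p)
      by (apply Rlt_trans with (2 := Hlt), Rmult_lt_0_compat; [lra | apply exp_pos]).
    assert (Hln : forall eps, 0 < eps -> ln p - ln M - INR m * G <= eps * Rabs G).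
    { intros eps Heps. generalize (H eps Heps). intros Hle. apply ln_le in Hle; [|exact Hp].
      rewrite ln_mult, ln_exp in Hle by (auto using exp_pos).
      assert (eps * G <= eps * Rabs G) by (apply Rmult_le_compat_l; [lra | apply Rle_abs]). lra. }
    assert (Hgap : 0 < ln p - ln M - INR m * G).
    { apply ln_increasing in Hlt; [|apply Rmult_lt_0_compat; [lra | apply exp_pos]].
      rewrite ln_mult, ln_exp in Hlt by (auto using exp_pos). lra. }
    set (gap := ln p - ln M - INR m * G) in *.
    assert (HG := Rabs_pos G).
    assert (Hq : 0 < gap / (2 * (Rabs G + 1))) by (apply Rdiv_lt_0_compat; lra).
    generalize (Hln _ Hq). intros Hle.
    assert (gap / (2 * (Rabs G + 1)) * (Rabs G + 1) = gap / 2) by (field; lra).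
    lra.
  - generalize (H 1 Rlt_0_1). rewrite Rmult_0_l in *. lra.
Qed.

(** * Separation of the nodes *)

(** The bound B excludes the value [p_infty], which [real] would send to 0. *)
Lemma Lub_Rbar_ge (E : R -> Prop) (t B : R) :
  E t -> (forall s, E s -> s <= B) -> t <= real (Lub_Rbar E).
Proof.
  intros Ht HB. destruct (Lub_Rbar_correct E) as [Hub Hleast].
  assert (H1 := Hub t Ht). assert (H2 := Hleast (Finite B) HB).
  destruct (Lub_Rbar E); simpl in *; tauto.
Qed.

Lemma diam_ge (K : R -> Prop) (x y : R) : compact K -> K x -> K y -> Rabs (x - y) <= diam K.
Proof.
  intros HK Kx Ky. destruct (compact_Rabs_bound K HK) as [rho Hrho].
  apply Lub_Rbar_ge with (2 * rho); [exists x, y; auto|].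
  intros s [u [v [Ku [Kv ->]]]]. unfold Rminus. apply Rle_trans with (1 := Rabs_triang _ _).
  rewrite Rabs_Ropp. generalize (Hrho u Ku) (Hrho v Kv). lra.
Qed.

Lemma Gfun_ge (K : R -> Prop) (g : C -> R) (delta x t : R) :
  compact K -> (forall z, contC g z) -> K x -> Rabs t <= 2 * delta ->
  g (x, t) <= Gfun K g delta.
Proof.
  intros HK Hcont Kx Ht. destruct (compact_Rabs_bound K HK) as [rho Hrho].
  assert (Hr0 := Hrho x Kx). assert (Hx0 := Rabs_pos x). assert (Ht0 := Rabs_pos t).
  (* Outside the disc of radius Rr the distance to K is at least 2 * delta + 1, so the set defining
     G lies in this square, where g is bounded. *)
  set (Rr := rho + 2 * delta + 1).
  destruct (rectangle_max (fun u v => g (u, v)) (- Rr) Rr (- Rr) Rr) as [x0 [y0 [_ [_ Hmax]]]].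
  { unfold Rr; lra. } { unfold Rr; lra. }
  { intros u v _ _. apply contC_continuity_2d, Hcont. }
  apply Lub_Rbar_ge with (g (x0, y0)).
  - exists (x, t). split; [|reflexivity].
    apply Rbar_le_trans with (Finite (Rabs t)); [|exact Ht].
    apply (proj1 (Glb_Rbar_correct _)). exists x. split; [exact Kx|].
    unfold Cmod; simpl. rewrite <- sqrt_Rsqr_abs. f_equal. unfold Rsqr. ring.
  - intros s [[u v] [Hd ->]].
    assert (HC : Cmod (u, v) <= Rr).
    { apply Rnot_lt_le. intros Hlt.
      assert (Hge : Rbar_le (Finite (2 * delta + 1)) (distK K (u, v))).
      { apply (proj2 (Glb_Rbar_correct _)). intros s [w [Kw ->]]. simpl.
        assert (H := Cmod_triangle (Cminus (u, v) (RtoC w)) (RtoC w)).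
        replace (Cplus (Cminus (u, v) (RtoC w)) (RtoC w)) with (u, v) in H
          by (apply injective_projections; simpl; ring).
        rewrite Cmod_R in H. generalize (Hrho w Kw). unfold Rr in Hlt. lra. }
      assert (H := Rbar_le_trans _ _ _ Hge Hd). simpl in H. lra. }
    assert (H := Rmax_Cmod (u, v)). simpl in H.
    generalize (Rmax_l (Rabs u) (Rabs v)) (Rmax_r (Rabs u) (Rabs v)). intros.
    apply Hmax; apply Rabs_le_between; lra.
Qed.

Lemma Cmod_sumC_le (n : nat) (f : nat -> C) (B : R) :
  (forall k, (k < n)%nat -> Cmod (f k) <= B) -> Cmod (sumC n f) <= INR n * B.
Proof.
  intros H. induction n as [|n IH]; cbn [sumC].
  - rewrite Cmod_0. simpl; lra.
  - rewrite S_INR. apply Rle_trans with (1 := Cmod_triangle _ _).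
    assert (H1 := IH (fun k Hk => H k (Nat.lt_lt_succ_r _ _ Hk))).
    assert (H2 := H n (Nat.lt_succ_diag_r n)). lra.
Qed.

Lemma dist2_ge_real (x y r : R) : Rabs (x - r) <= dist2 x y r.
Proof.
  unfold dist2. rewrite <- sqrt_Rsqr_abs. apply sqrt_le_1_alt.
  unfold Rsqr. generalize (pow2_ge_0 y). simpl. lra.
Qed.

Lemma dist2_ge_imag (x y r : R) : Rabs y <= dist2 x y r.
Proof.
  unfold dist2. rewrite <- sqrt_Rsqr_abs. apply sqrt_le_1_alt.
  unfold Rsqr. generalize (pow2_ge_0 (x - r)). simpl. lra.
Qed.

(* Since all nodes are real, moving from x_k up to x_k + i * delta does not decrease any
   factor, and the factor of x_i becomes at least delta. *)
Lemma leja_separation (K : R -> Prop) (g : C -> R) (tau delta : R) (n : nat) (xs : nat -> R)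
    (i k : nat) :
  compact K -> green_inf K g -> (forall z, contC g z) -> 0 < tau -> quasi_Leja K tau n xs ->
  0 < delta -> (i < k)%nat -> (k < n)%nat ->
  tau * delta * exp (- (INR n * Gfun K g delta)) <= Rabs (xs k - xs i).
Proof.
  intros HK Hgreen Hcont Htau [HKx Hleja] Hdelta Hik Hkn.
  set (G := Gfun K g delta).
  assert (Hdl : Rabs delta = delta) by (apply Rabs_right; lra).
  assert (Hg : g (xs k, delta) <= G) by (apply Gfun_ge; auto; lra).
  assert (HG0 : 0 <= G).
  { rewrite <- (proj1 (proj2 Hgreen) (xs k, 0)) by (split; simpl; auto).
    apply Gfun_ge; auto. rewrite Rabs_R0; lra. }
  set (P := prodR k (fun j => Rabs (xs k - xs j))).
  assert (HP0 : 0 <= P) by (apply prodR_nonneg; intros; apply Rabs_pos).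
  assert (Hti : 0 < / tau) by (apply Rinv_0_lt_compat; lra).
  assert (HBW := bernstein_walsh K g xs k (/ tau * P) (xs k) delta HK Hgreen Hcont
    (fun j Hj => HKx j ltac:(lia)) (Rmult_le_pos _ _ (Rlt_le _ _ Hti) HP0)).
  assert (HM : forall x, K x -> prodR k (fun j => Rabs (x - xs j)) <= / tau * P).
  { intros x Kx. apply Rmult_le_reg_l with tau; [lra|].
    rewrite <- Rmult_assoc, Rinv_r, Rmult_1_l by lra. apply Rge_le, Hleja; auto; lia. }
  specialize (HBW HM).
  assert (HL : 0 < prodR k (fun j => dist2 (xs k) delta (xs j))).
  { apply prodR_pos. intros j _. generalize (dist2_ge_imag (xs k) delta (xs j)). lra. }
  set (Q := prodR k (fun j => if Nat.eqb j i then 1 else Rabs (xs k - xs j))).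
  assert (HPQ : P = Rabs (xs k - xs i) * Q)
    by exact (prodR_split k i (fun j => Rabs (xs k - xs j)) Hik).
  assert (HQ0 : 0 <= Q).
  { apply prodR_nonneg. intros j _. destruct (Nat.eqb j i); [lra | apply Rabs_pos]. }
  assert (HLQ : delta * Q <= prodR k (fun j => dist2 (xs k) delta (xs j))).
  { rewrite (prodR_split k i) by exact Hik. apply Rmult_le_compat; [lra | exact HQ0 | |].
    - rewrite <- Hdl at 1. apply dist2_ge_imag.
    - apply prodR_le. intros j _. destruct (Nat.eqb j i); [lra|].
      split; [apply Rabs_pos | apply dist2_ge_real]. }
  assert (Hexp : exp (INR k * g (xs k, delta)) <= exp (INR n * G)).
  { assert (Hle : INR k * g (xs k, delta) <= INR n * G).
    { apply Rle_trans with (INR k * G); [apply Rmult_le_compat_l; [apply pos_INR | exact Hg]|].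
      apply Rmult_le_compat_r; [exact HG0 | apply le_INR; lia]. }
    destruct Hle as [Hle|Hle]; [left; apply exp_increasing, Hle | rewrite Hle; lra]. }
  assert (HMpos : 0 <= / tau * P) by (apply Rmult_le_pos; lra).
  assert (Htot : prodR k (fun j => dist2 (xs k) delta (xs j)) <= / tau * P * exp (INR n * G)).
  { apply Rle_trans with (1 := HBW). apply Rmult_le_compat_l; assumption. }
  assert (He := exp_pos (INR n * G)).
  (* The nodes are not known to be distinct at this point. A vanishing Q would annihilate the
     right-hand side of [Htot], whose left-hand side is positive because delta > 0. *)
  assert (HQ : 0 < Q).
  { destruct HQ0 as [|E]; [assumption|]. rewrite HPQ, <- E, Rmult_0_r, Rmult_0_r in Htot. lra. }
  rewrite exp_Ropp.
  apply Rmult_le_reg_r with (/ tau * exp (INR n * G) * Q).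
  { apply Rmult_lt_0_compat; [apply Rmult_lt_0_compat|]; assumption. }
  replace (tau * delta * / exp (INR n * G) * (/ tau * exp (INR n * G) * Q)) with (delta * Q)
    by (field; lra).
  rewrite HPQ in Htot. lra.
Qed.

(** * The bound for the Lebesgue constant *)

Theorem theorem2 (K : R -> Prop) (g : C -> R) (lambda tau : R) (n : nat) (xs : nat -> R) :
  compact K ->
  green_inf K g ->
  (forall z, contC g z) ->
  0 < lambda -> exp (exp lambda) * (exp lambda - 1) = 1 ->
  0 < tau -> tau <= 1 ->
  (1 <= n)%nat ->
  quasi_Leja K tau n xs ->
  forall delta, 0 < delta ->
    Rbar_le (lebesgue_const K n xs)
      (2 / tau ^ 2 * INR n *
         Rpower (diam K / (tau * delta) * exp (INR n * Gfun K g delta))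
                (9 / 8 + 2 / lambda * ln (1 / tau))).
Proof.
  intros HK Hgreen Hcont Hlam Heq Htau Htau1 Hn Hleja delta Hdelta.
  assert (K0 : K (xs 0%nat)) by (apply (proj1 Hleja); lia).
  set (G := Gfun K g delta). set (D := diam K).
  set (d := tau * delta * exp (- (INR n * G))).
  assert (Hd : 0 < d) by (apply Rmult_lt_0_compat; [nra | apply exp_pos]).
  assert (Hg : g (xs 0%nat, delta) <= G).
  { apply Gfun_ge; auto. rewrite Rabs_right; lra. }
  assert (HG0 : 0 <= G).
  { rewrite <- (proj1 (proj2 Hgreen) (xs 0%nat, 0)) by (split; simpl; auto).
    apply Gfun_ge; auto. rewrite Rabs_R0; lra. }
  assert (Hdiam : forall x y, K x -> K y -> Rabs (x - y) <= D) by (intros; apply diam_ge; auto).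
  assert (HD0 : 0 <= D) by (apply Rle_trans with (2 := Hdiam _ _ K0 K0), Rabs_pos).
  (* When n = 1 there is no pair of nodes from which to compare d with D. The Bernstein-Walsh
     inequality for the linear polynomial z - x_0, taken at x_0 + i * delta, gives the comparison
     for every n and shows in particular that D > 0. *)
  assert (HdD : d <= D).
  { assert (HBW : delta <= D * exp (INR n * G)).
    { apply Rle_trans with (dist2 (xs 0%nat) delta (xs 0%nat)).
      { rewrite <- (Rabs_right delta) at 1 by lra. apply dist2_ge_imag. }
      assert (HB := bernstein_walsh K g xs 1 D (xs 0%nat) delta HK Hgreen Hcont
        (fun j Hj => proj1 Hleja j ltac:(lia)) HD0).
      simpl in HB. rewrite !Rmult_1_l in HB. apply Rle_trans with (1 := HB ltac:(
        intros x Kx; rewrite Rmult_1_l; auto)).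
      apply Rmult_le_compat_l; [exact HD0|].
      assert (Hle : g (xs 0%nat, delta) <= INR n * G).
      { assert (H1 : 1 <= INR n) by (apply (le_INR 1); exact Hn). nra. }
      destruct Hle as [Hle|Hle]; [left; apply exp_increasing, Hle | rewrite Hle; lra]. }
    unfold d. rewrite exp_Ropp. assert (He := exp_pos (INR n * G)).
    apply Rle_div_l; [exact He|]. nra. }
  assert (Hbase : D / (tau * delta) * exp (INR n * G) = D / d).
  { unfold d. rewrite exp_Ropp. assert (He := exp_pos (INR n * G)). field. lra. }
  fold D G. rewrite Hbase.
  assert (Hsep : forall i j, (i < n)%nat -> (j < n)%nat -> i <> j -> d <= Rabs (xs i - xs j)).
  { intros i j Hi Hj Hij. destruct (Nat.lt_total i j) as [Hlt | [Heqij | Hlt]]; [|lia|].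
    - rewrite Rabs_minus_sym. apply leja_separation; auto.
    - apply leja_separation; auto. }
  apply (proj2 (Lub_Rbar_correct _)). intros t [f [x [_ [Hf [Kx ->]]]]]. simpl.
  rewrite (Rmult_comm (2 / tau ^ 2)), Rmult_assoc.
  apply Cmod_sumC_le. intros k Hk.
  rewrite Cmod_mult, Cmod_R, <- (Rmult_1_l (2 / _ * _)).
  apply Rmult_le_compat; [apply Cmod_ge_0 | apply Rabs_pos | apply Hf, (proj1 Hleja); exact Hk |].
  apply (lagrange_bound K xs n k lambda tau d D); auto.
Qed.
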